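(* Let $\alpha\in(0,1)$ be irrational with bounded continued fraction coefficients $(a_n)_{n\in\mathbb N}$. Let $(n_i)_{i\in\mathbb N}$ be a strictly increasing sequence of positive integers such that both limits $$\lim_{i\to\infty}\alpha_{n_i}^+=\lim_{i\to\infty}[a_{n_i};a_{n_i+1},a_{n_i+2},\ldots]\quad\text{and}\quad\lim_{i\to\infty}\alpha_{n_i}^-=\lim_{i\to\infty}[0;a_{n_i-1},a_{n_i-2},\ldots,a_1]$$ exist. Then there exists a constant $C>0$ such that $\lim_{i\to\infty}P_{q_{n_i}}(\alpha)=C$.
   Context: $P_N(\alpha)=\prod_{r=1}^N|2\sin(\pi r\alpha)|$. $\alpha=[0;a_1,a_2,\ldots]$, and its convergent denominators are $q_0=0$, $q_1=1$, $q_{n+1}=a_nq_n+q_{n-1}$. *)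

(* Defs.v *)
From Stdlib Require Import Reals Lra Lia ZArith.
Open Scope R_scope.

(* Gauss map iterates: x_0 = alpha, x_{n+1} = 1/x_n - floor(1/x_n).
   For alpha = [0; a_1, a_2, ...] irrational, x_n = [0; a_{n+1}, a_{n+2}, ...]. *)
Fixpoint gauss_iter (alpha : R) (n : nat) : R :=
  match n with
  | O => alpha
  | S m => let y := gauss_iter alpha m in / y - IZR (Int_part (/ y))
  end.

(* Continued fraction coefficients: a_n = floor(1/x_{n-1}) for n >= 1
   (a_0 is unused; set to 0). *)
Definition cf_a (alpha : R) (n : nat) : nat :=
  match n with
  | O => O
  | S m => Z.to_nat (Int_part (/ gauss_iter alpha m))
  end.

Fixpoint qpair (alpha : R) (n : nat) : nat * nat :=
  match n with
  | O => (O, 1%nat)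
  | S m => let (qm, qm1) := qpair alpha m in (qm1, (cf_a alpha (S m) * qm1 + qm)%nat)
  end.

Definition cf_q (alpha : R) (n : nat) : nat := fst (qpair alpha n).

(* alpha_n^+ = [a_n; a_{n+1}, a_{n+2}, ...] = a_n + x_n  (n >= 1). *)
Definition alpha_plus (alpha : R) (n : nat) : R :=
  INR (cf_a alpha n) + gauss_iter alpha n.

(* alpha_n^- = [0; a_{n-1}, a_{n-2}, ..., a_1]  (n >= 1):
   alpha_1^- = [0;] = 0, alpha_{n+1}^- = 1 / (a_n + alpha_n^-). *)
Fixpoint alpha_minus (alpha : R) (n : nat) : R :=
  match n with
  | O => 0
  | S O => 0
  | S m => / (INR (cf_a alpha m) + alpha_minus alpha m)
  end.

Fixpoint sine_prod (N : nat) (alpha : R) : R :=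
  match N with
  | O => 1
  | S m => sine_prod m alpha * Rabs (2 * sin (PI * INR (S m) * alpha))
  end.

Definition irrational (x : R) : Prop :=
  ~ exists (p q : Z), q <> 0%Z /\ x = IZR p / IZR q.

(* Main.v *)
(* Write q = q_n, b = alpha_n^- = q_{n-1}/q_n and lam = q |q alpha - p_n| = 1/(alpha_n^+ + alpha_n^-) < 1.
   Reindexing the product by r = t q_{n-1} mod q gives
     P_q(alpha) = 2 sin(pi lam/q) prod_{t=1}^{q-1} 2 sin(pi (t - lam {t b})/q),
   and prod_{t=1}^{q-1} 2 sin(pi t/q) = q.  After dividing by this product, the logarithms of the factors
   t and q - t add up to a term which converges along n_i for each fixed t (t b stays away from the
   integers because the coefficients are bounded), and which equals
     - 2 (pi lam/q) cot(pi t/q) ({t b} - 1/2) + O(1/t^2)   for t <= q/2.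
   Splitting 1..N into blocks whose length is the denominator, of order sqrt N, of a convergent of b shows
   that the sums of {t b} - 1/2 are O(sqrt N) uniformly in n, so by partial summation the terms with
   t > T contribute O(1/sqrt T) uniformly in n.  Hence log P_{q_{n_i}}(alpha) is a Cauchy sequence,
   and C is the exponential of its limit. *)

Require Import Defs.
From Stdlib Require Import Reals Lra Lia List Permutation ZArith.
From mathcomp Require all_boot all_algebra Rstruct ring.
Open Scope R_scope.

(** The obstacle is uniformity in n. The number alpha_n^- is rational with coefficients a_{n-1},
    ..., a_1, so its expansion inherits the bound M of alpha, and its successive convergent
    denominators grow by a factor of at most M + 1. Every size up to q_n is therefore met by a
    denominator up to that factor. These convergents serve twice: they balance the fractional parts
    over a block, and they keep t b at a distance from the integers that depends on t and M only.
    Pairing is forced: a single factor with t <= q/2 contributes about - lam {t b}/t, and such sums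
    grow like log q. Adding the factor at q - t, where {t b} is replaced by {t b} - 1, centres the
    fractional part at 1/2. Index [S n] in the lemmas plays the role of n above, because q_0 = 0
    allows no division. *)

Lemma sin_grid_pos (q k : nat) : (0 < k)%nat /\ (k < q)%nat -> 0 < sin (PI * INR k / INR q).
Proof.
intros [k0 kq]. apply lt_INR in k0, kq. simpl in k0. pose proof PI_RGT_0.
apply sin_gt_0.
- apply Rdiv_lt_0_compat; nra.
- apply Rmult_lt_reg_r with (INR q); [lra|]. field_simplify; nra.
Qed.

Lemma sin_grid_period (q k : nat) : sin (INR (S q) * (PI * INR k / INR (S q))) = 0.
Proof.
apply sin_eq_0_1. exists (Z.of_nat k). rewrite <- INR_IZR_INZ. field.
apply not_0_INR. discriminate.
Qed.

Lemma cos_grid_inj (q k l : nat) : (k < S q)%nat -> (l < S q)%nat ->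
  cos (PI * INR k / INR (S q)) = cos (PI * INR l / INR (S q)) -> k = l.
Proof.
assert (B : forall k, (k < S q)%nat -> 0 <= PI * INR k / INR (S q) <= PI).
{ intros m h. pose proof PI_RGT_0. pose proof (pos_INR m). apply lt_INR in h. split.
  - apply Rmult_le_pos; [nra|]. left; apply Rinv_0_lt_compat; lra.
  - apply Rmult_le_reg_r with (INR (S q)); [lra|]. field_simplify; nra. }
intros hk hl h. apply cos_inj in h; auto. apply INR_eq.
pose proof PI_RGT_0. assert (INR (S q) <> 0) by (apply not_0_INR; discriminate).
apply (f_equal (fun x => x * INR (S q) / PI)) in h. field_simplify in h; lra.
Qed.

(** * Chebyshev polynomials and the product of 2 - 2 cos (pi k / (q + 1)) *)

Module ChebyshevPoly.
Import all_boot all_algebra Rstruct ring GRing.Theory.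
Local Open Scope ring_scope.

(* [(S_(n-1), S_n)], where [S_n] is the monic Chebyshev polynomial with
   [S_n (2 cos x) sin x = sin ((n + 1) x)]. *)
Fixpoint chebS (n : nat) : {poly R} * {poly R} :=
  if n is m.+1 then ((chebS m).2, (chebS m).2 * 'X - (chebS m).1) else (0, 1).

Lemma chebS_size_monic n :
  [/\ (size (chebS n).1 <= n)%N, size (chebS n).2 = n.+1 & (chebS n).2 \is monic].
Proof.
elim: n => [|n [s1 s2 m]] /=; first by rewrite size_poly0 size_poly1 monic1.
have sX : size ((chebS n).2 * 'X) = n.+2 by rewrite size_mulX ?monic_neq0 // s2.
have lt : (size (- (chebS n).1)%R < size ((chebS n).2 * 'X)%R)%N.
  by rewrite size_polyN sX; apply: leq_ltn_trans s1 _.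
split; [by rewrite s2 | by rewrite size_polyDl |].
by rewrite monicE lead_coefDl // lead_coefMX -monicE.
Qed.

(** The factorisation is evaluated at 2 = 2 cos 0, where [chebS_sin] is empty because sin 0 = 0; the
    value has to come from the recurrence. *)
Lemma chebS_at2 n : (chebS n).1.[2%:R] = n%:R /\ (chebS n).2.[2%:R] = n.+1%:R.
Proof.
elim: n => [|n [h1 h2]] /=; first by rewrite !hornerE.
split=> //; rewrite !hornerE h1 h2.
by rewrite -[in RHS]addn1 -[n.+1]addn1 !natrD; ring.
Qed.

Lemma chebS_sin n (x : R) :
  (chebS n).1.[2%:R * cos x] * sin x = sin (INR n * x) /\
  (chebS n).2.[2%:R * cos x] * sin x = sin (INR n.+1 * x).
Proof.
elim: n => [|n [h1 h2]]; rewrite [chebS _]/=.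
  by rewrite !hornerE ?mul0r ?mul1r; split=> //; exact/esym/sin_0.
split=> //; rewrite hornerD hornerN hornerMX mulrBl h1 mulrAC h2.
have -> : sin (INR n.+2 * x) = sin (INR n.+1 * x + x).
  by rewrite [INR n.+2]S_INR Rmult_plus_distr_r Rmult_1_l.
have -> : sin (INR n * x) = sin (INR n.+1 * x - x).
  by rewrite [INR n.+1]S_INR Rmult_plus_distr_r Rmult_1_l /Rminus Rplus_assoc Rplus_opp_r Rplus_0_r.
by rewrite sin_plus sin_minus !RealsE; ring.
Qed.

(** The q numbers 2 cos (pi k / (q + 1)) are distinct zeros of the monic polynomial S_q of degree q,
    hence all its roots, and the product is S_q (2) = q + 1. *)
Lemma prod_two_sub_two_cos (q : nat) :
  INR q.+1 =
  List.fold_right Rmult (IZR 1)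
    (List.map (fun k => Rminus (IZR 2) (Rmult (IZR 2) (cos (PI * INR k / INR q.+1))))
       (List.seq 1 q)).
Proof.
pose c k : R := 2%:R * cos (PI * INR k / INR q.+1).
have [_ sz mon] := chebS_size_monic q.
have E : (chebS q).2 = \prod_(z <- [seq c k | k <- iota 1 q]) ('X - z%:P).
  rewrite [LHS](@all_roots_prod_XsubC _ _ [seq c k | k <- iota 1 q]) ?(monicP mon) ?scale1r //.
  - by rewrite sz size_map size_iota.
  - apply/allP => z /mapP[k]; rewrite mem_iota add1n => /andP[k0 kq] ->.
    have h := sin_grid_pos _ _ (conj (elimT ltP k0) (elimT ltP kq)).
    have s0 : sin (PI * INR k / INR q.+1) != 0.
      by apply/eqP => e; move: h; rewrite e => /Rlt_irrefl.
    rewrite rootE -(mulIr_eq0 _ (mulIf s0)); apply/eqP.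
    by rewrite (chebS_sin q _).2 sin_grid_period.
  - rewrite uniq_rootsE map_inj_in_uniq ?iota_uniq // => k l.
    rewrite !mem_iota !add1n => /andP[_ /ltP kq] /andP[_ /ltP lq].
    move/(mulfI (_ : 2%:R != 0 :> R)) => h; apply: (cos_grid_inj _ _ _ kq lq); apply: h.
    by rewrite Num.Theory.pnatr_eq0.
have iotaE F s : forall m,
    \prod_(k <- iota m s) F k = List.fold_right Rmult (IZR 1) (List.map F (List.seq m s)).
  by elim: s => [|s IH] m; [rewrite big_nil | rewrite /= big_cons IH].
have H := (chebS_at2 q).2; rewrite E -[q.+1%:R]INRE in H; rewrite -[LHS]H.
rewrite big_map horner_prod iotaE; congr (List.fold_right _ _ _).
by apply: List.map_ext => k; rewrite hornerD hornerN hornerX hornerC.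
Qed.
End ChebyshevPoly.

(** * Finite sums over lists of indices *)

Lemma Rabs_le_inv (x a : R) : Rabs x <= a -> - a <= x <= a.
Proof. unfold Rabs. destruct (Rcase_abs x); lra. Qed.

Definition rsum (f : nat -> R) (l : list nat) : R := fold_right (fun t s => f t + s) 0 l.

Lemma rsum_app (f : nat -> R) (l1 l2 : list nat) : rsum f (l1 ++ l2) = rsum f l1 + rsum f l2.
Proof. induction l1 as [|a l1 IH]; simpl; [|rewrite IH]; lra. Qed.

Lemma rsum_seq_S (f : nat -> R) (a n : nat) : rsum f (seq a (S n)) = rsum f (seq a n) + f (a + n)%nat.
Proof. rewrite seq_S, rsum_app. simpl. lra. Qed.

Lemma rsum_perm (f : nat -> R) (l1 l2 : list nat) : Permutation l1 l2 -> rsum f l1 = rsum f l2.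
Proof. induction 1; simpl; lra. Qed.

Lemma rsum_map (f : nat -> R) (h : nat -> nat) (l : list nat) : rsum f (map h l) = rsum (fun t => f (h t)) l.
Proof. induction l as [|a l IH]; simpl; [|rewrite IH]; reflexivity. Qed.

Lemma rsum_ext (f g : nat -> R) (l : list nat) : (forall t, In t l -> f t = g t) -> rsum f l = rsum g l.
Proof.
induction l as [|a l IH]; simpl; intros h; [reflexivity|].
rewrite (h a), IH; auto.
Qed.

Lemma rsum_plus (f g : nat -> R) (l : list nat) : rsum (fun t => f t + g t) l = rsum f l + rsum g l.
Proof. induction l as [|a l IH]; simpl; [|rewrite IH]; lra. Qed.

Lemma rsum_scal (c : R) (f : nat -> R) (l : list nat) : rsum (fun t => c * f t) l = c * rsum f l.
Proof. induction l as [|a l IH]; simpl; [|rewrite IH]; lra. Qed.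

Lemma rsum_const (c : R) (l : list nat) : rsum (fun _ => c) l = INR (length l) * c.
Proof.
induction l as [|a l IH]; [simpl; lra|].
change (length (a :: l)) with (S (length l)). rewrite S_INR. simpl. rewrite IH. lra.
Qed.

Lemma rsum_le (f g : nat -> R) (l : list nat) :
  (forall t, In t l -> f t <= g t) -> rsum f l <= rsum g l.
Proof.
induction l as [|a l IH]; simpl; intros h; [lra|].
apply Rplus_le_compat; auto.
Qed.

Lemma rsum_abs (f g : nat -> R) (l : list nat) :
  (forall t, In t l -> Rabs (f t) <= g t) -> Rabs (rsum f l) <= rsum g l.
Proof.
induction l as [|a l IH]; simpl; intros h; [rewrite Rabs_R0; lra|].
eapply Rle_trans; [apply Rabs_triang|]. apply Rplus_le_compat; auto.
Qed.

Lemma perm_map_endo (h : nat -> nat) (l : list nat) :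
  NoDup l -> (forall s t, In s l -> In t l -> h s = h t -> s = t) ->
  (forall t, In t l -> In (h t) l) -> Permutation (map h l) l.
Proof.
intros nd inj into.
apply NoDup_Permutation_bis.
- apply NoDup_map_NoDup_ForallPairs; [|exact nd]. intros s t hs ht. auto.
- rewrite length_map. lia.
- intros x hx. apply in_map_iff in hx. destruct hx as [t [<- ht]]. auto.
Qed.

Lemma rsum_rev (f : nat -> R) (a m : nat) :
  rsum f (seq a m) = rsum (fun t => f (a + a + m - 1 - t)%nat) (seq a m).
Proof.
symmetry. rewrite <- (rsum_map f (fun t => (a + a + m - 1 - t)%nat)). apply rsum_perm, perm_map_endo.
- apply seq_NoDup.
- intros s t hs ht. rewrite in_seq in hs, ht. lia.
- intros t ht. rewrite in_seq in *. lia.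
Qed.

(** Coprimality of [h] and [k] is carried by explicit Bezout coefficients, which the determinant of
    consecutive convergents supplies; j -> a + j h then permutes the residues modulo k. *)
Lemma rsum_affine_mod (f : nat -> R) (k : nat) (a h u v : Z) : (0 < k)%nat ->
  (h * u + Z.of_nat k * v = 1)%Z ->
  rsum (fun j => f (Z.to_nat ((a + Z.of_nat j * h) mod Z.of_nat k))) (seq 0 k) = rsum f (seq 0 k).
Proof.
intros k0 bez. rewrite <- (rsum_map f (fun j => Z.to_nat ((a + Z.of_nat j * h) mod Z.of_nat k))).
apply rsum_perm, perm_map_endo; [apply seq_NoDup| |].
- intros s t hs ht e. rewrite in_seq in hs, ht.
  pose proof (Z.mod_pos_bound (a + Z.of_nat s * h) (Z.of_nat k) ltac:(lia)).
  pose proof (Z.mod_pos_bound (a + Z.of_nat t * h) (Z.of_nat k) ltac:(lia)).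
  apply Z2Nat.inj in e; try lia.
  pose proof (Z.div_mod (a + Z.of_nat s * h) (Z.of_nat k) ltac:(lia)) as e1.
  pose proof (Z.div_mod (a + Z.of_nat t * h) (Z.of_nat k) ltac:(lia)) as e2.
  set (d1 := ((a + Z.of_nat s * h) / Z.of_nat k)%Z) in *.
  set (d2 := ((a + Z.of_nat t * h) / Z.of_nat k)%Z) in *.
  (* Multiplying s - t by h u + k v = 1 exhibits it as a multiple of k, while |s - t| < k. *)
  assert (E : (Z.of_nat s - Z.of_nat t = Z.of_nat k * ((d1 - d2) * u + (Z.of_nat s - Z.of_nat t) * v))%Z).
  { replace (Z.of_nat s - Z.of_nat t)%Z with
      ((Z.of_nat s - Z.of_nat t) * (h * u + Z.of_nat k * v))%Z at 1 by (rewrite bez; ring).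
    assert ((Z.of_nat s - Z.of_nat t) * h = Z.of_nat k * (d1 - d2))%Z by lia.
    replace ((Z.of_nat s - Z.of_nat t) * (h * u + Z.of_nat k * v))%Z with
      ((Z.of_nat s - Z.of_nat t) * h * u + Z.of_nat k * ((Z.of_nat s - Z.of_nat t) * v))%Z by ring.
    rewrite H1. ring. }
  set (w := ((d1 - d2) * u + (Z.of_nat s - Z.of_nat t) * v)%Z) in *.
  assert (w = 0)%Z by nia. nia.
- intros t ht. rewrite in_seq in *.
  pose proof (Z.mod_pos_bound (a + Z.of_nat t * h) (Z.of_nat k) ltac:(lia)). lia.
Qed.

(** * Fractional parts and their sums along arithmetic progressions *)

Lemma frac_unique (x f : R) (z : Z) : x = IZR z + f -> 0 <= f < 1 -> frac_part x = f.
Proof.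
intros e hf. unfold frac_part. replace (Int_part x) with z; [lra|].
apply Int_part_spec. lra.
Qed.

Lemma frac_bounds (x : R) : 0 <= frac_part x < 1.
Proof. destruct (base_fp x). lra. Qed.

(** A wrap-around only lowers the fractional part, so this one-sided bound holds without any case
    distinction. *)
Lemma frac_add_le (x e : R) : 0 <= e -> frac_part (x + e) <= frac_part x + e.
Proof.
intros he. pose proof (frac_bounds x). pose proof (frac_bounds (x + e)).
unfold frac_part in *.
assert (IZR (Int_part x) < IZR (Int_part (x + e)) + 1) by lra.
rewrite <- plus_IZR in H1. apply lt_IZR in H1.
assert (Int_part x <= Int_part (x + e))%Z by lia. apply IZR_le in H2. lra.
Qed.

Lemma rsum_id (k : nat) : rsum INR (seq 0 k) = INR k * (INR k - 1) / 2.
Proof.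
induction k as [|k IH]; [simpl; lra|].
rewrite rsum_seq_S, IH, S_INR, Nat.add_0_l. lra.
Qed.

(** With k x = a + xi, the terms are (r + xi)/k - 1/2 where r runs once through the residues modulo
    k, so the sum is exactly xi - 1/2. *)
Lemma rsum_frac_rational (x : R) (k : nat) (h u v : Z) : (0 < k)%nat ->
  (h * u + Z.of_nat k * v = 1)%Z ->
  Rabs (rsum (fun j => frac_part (x + INR j * (IZR h / INR k)) - / 2) (seq 0 k)) <= / 2.
Proof.
intros k0 bez. assert (K : 0 < INR k) by now apply lt_0_INR.
set (a := Int_part (INR k * x)). set (xi := frac_part (INR k * x)).
assert (hxi : 0 <= xi < 1) by apply frac_bounds.
assert (hx : INR k * x = IZR a + xi) by (unfold a, xi, frac_part; lra).
rewrite (rsum_ext _ (fun j => INR (Z.to_nat ((a + Z.of_nat j * h) mod Z.of_nat k)) / INR k + xi / INR k - / 2)).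
2:{ intros j _. f_equal.
  pose proof (Z.mod_pos_bound (a + Z.of_nat j * h) (Z.of_nat k) ltac:(lia)) as mb.
  apply (frac_unique _ _ ((a + Z.of_nat j * h) / Z.of_nat k)).
  - rewrite (INR_IZR_INZ (Z.to_nat _)), Z2Nat.id by lia.
    pose proof (Z.div_mod (a + Z.of_nat j * h) (Z.of_nat k) ltac:(lia)) as e1.
    apply (f_equal IZR) in e1. rewrite !plus_IZR, !mult_IZR, <- !INR_IZR_INZ in e1.
    apply Rmult_eq_reg_l with (INR k); [|lra]. field_simplify; try lra.
  - rewrite (INR_IZR_INZ (Z.to_nat _)), Z2Nat.id by lia.
    destruct mb as [mb1 mb2]. apply IZR_le in mb1.
    assert (mb3 : (((a + Z.of_nat j * h) mod Z.of_nat k) + 1 <= Z.of_nat k)%Z) by lia.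
    apply IZR_le in mb3. rewrite plus_IZR, <- INR_IZR_INZ in mb3.
    split.
    + apply Rplus_le_le_0_compat; apply Rle_mult_inv_pos; lra.
    + apply Rmult_lt_reg_r with (INR k); [lra|]. field_simplify; lra. }
rewrite (rsum_affine_mod (fun i => INR i / INR k + xi / INR k - / 2) k a h u v k0 bez).
rewrite (rsum_ext _ (fun i => / INR k * INR i + (xi / INR k - / 2))) by (intros; lra).
rewrite rsum_plus, rsum_scal, rsum_const, rsum_id, length_seq.
replace (/ INR k * (INR k * (INR k - 1) / 2) + INR k * (xi / INR k - / 2)) with (xi - / 2) by (field; lra).
apply Rabs_le. lra.
Qed.

(* Shifting the starting point by [-1/k] or [1/k] absorbs the drift [j (b - h/k)],
   so no fractional part is compared across a wrap-around. *)
Lemma rsum_frac_block (x b : R) (k : nat) (h u v : Z) : (0 < k)%nat ->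
  (h * u + Z.of_nat k * v = 1)%Z -> Rabs (INR k * b - IZR h) <= / INR k ->
  Rabs (rsum (fun j => frac_part (x + INR j * b) - / 2) (seq 0 k)) <= 5 / 2.
Proof.
intros k0 bez hb. assert (K : 0 < INR k) by now apply lt_0_INR.
assert (D : forall j, In j (seq 0 k) -> Rabs (INR j * (b - IZR h / INR k)) <= / INR k).
{ intros j hj. apply in_seq in hj. rewrite Rabs_mult, (Rabs_pos_eq (INR j)) by apply pos_INR.
  replace (b - IZR h / INR k) with ((INR k * b - IZR h) / INR k) by (field; lra).
  unfold Rdiv. rewrite Rabs_mult, (Rabs_pos_eq (/ INR k)) by (left; apply Rinv_0_lt_compat; lra).
  assert (INR j <= INR k) by (apply le_INR; lia). pose proof (pos_INR j).
  pose proof (Rabs_pos (INR k * b - IZR h)).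
  assert (INR j * / INR k <= 1) by (apply Rmult_le_reg_r with (INR k); [lra|]; field_simplify; lra).
  assert (0 <= INR j * / INR k) by (apply Rle_mult_inv_pos; lra). nra. }
assert (S1 := rsum_frac_rational (x - / INR k) k h u v k0 bez).
assert (S2 := rsum_frac_rational (x + / INR k) k h u v k0 bez).
apply Rabs_le_inv in S1, S2.
(* Each of the k terms moves by at most 2/k, so the drift costs 2 in total: 1/2 + 2 = 5/2. *)
assert (C : rsum (fun _ => 2 / INR k) (seq 0 k) = 2).
{ rewrite rsum_const, length_seq. field. lra. }
apply Rabs_le. split.
- assert (rsum (fun j => frac_part (x + / INR k + INR j * (IZR h / INR k)) - / 2) (seq 0 k)
     <= rsum (fun j => (frac_part (x + INR j * b) - / 2) + 2 / INR k) (seq 0 k)).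
  { apply rsum_le. intros j hj. apply D, Rabs_le_inv in hj.
    pose proof (frac_add_le (x + INR j * b) (/ INR k - INR j * (b - IZR h / INR k)) ltac:(lra)) as L.
    replace (x + INR j * b + (/ INR k - INR j * (b - IZR h / INR k)))
      with (x + / INR k + INR j * (IZR h / INR k)) in L by (field; lra). lra. }
  rewrite rsum_plus, C in H. lra.
- assert (rsum (fun j => frac_part (x + INR j * b) - / 2) (seq 0 k)
     <= rsum (fun j => (frac_part (x - / INR k + INR j * (IZR h / INR k)) - / 2) + 2 / INR k) (seq 0 k)).
  { apply rsum_le. intros j hj. apply D, Rabs_le_inv in hj.
    pose proof (frac_add_le (x - / INR k + INR j * (IZR h / INR k)) (/ INR k + INR j * (b - IZR h / INR k)) ltac:(lra)) as L.
    replace (x - / INR k + INR j * (IZR h / INR k) + (/ INR k + INR j * (b - IZR h / INR k)))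
      with (x + INR j * b) in L by (field; lra). lra. }
  rewrite rsum_plus, C in H. lra.
Qed.

Lemma rsum_ln_prod (F : nat -> R) (l : list nat) : (forall t, In t l -> 0 < F t) ->
  0 < fold_right Rmult 1 (map F l) /\
  ln (fold_right Rmult 1 (map F l)) = rsum (fun t => ln (F t)) l.
Proof.
induction l as [|a l IH]; simpl; intros h.
- rewrite ln_1. lra.
- destruct IH as [p e]; [auto|]. specialize (h a (or_introl eq_refl)).
  split; [nra|]. rewrite ln_mult, e; auto.
Qed.

(** Since 2 - 2 cos 2y = (2 sin y)^2, the Chebyshev product gives q as the square of a product of
    half-angle sines. Reflecting one of the two copies by t -> q - t turns its sines into cosines,
    and (2 sin y) (2 cos y) = 2 sin 2y restores the full angles. *)
Lemma rsum_ln_two_sin (q : nat) : (0 < q)%nat ->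
  rsum (fun t => ln (2 * sin (PI * INR t / INR q))) (seq 1 (q - 1)) = ln (INR q).
Proof.
destruct q as [|q]; intros q0; [lia|]. replace (S q - 1)%nat with q by lia.
assert (Q : 0 < INR (S q)) by (apply lt_0_INR; lia).
assert (P : forall t, In t (seq 1 q) -> 0 < sin (PI * INR t / INR (S q) / 2)).
{ intros t ht. apply in_seq in ht.
  replace (PI * INR t / INR (S q) / 2) with (PI * INR t / INR (2 * S q)).
  - apply sin_grid_pos. lia.
  - rewrite mult_INR. simpl (INR 2). field. lra. }
set (L := fun t => ln (2 * sin (PI * INR t / INR (S q) / 2))).
assert (E : 2 * rsum L (seq 1 q) = ln (INR (S q))).
{ rewrite ChebyshevPoly.prod_two_sub_two_cos.
  assert (D : forall t, 2 - 2 * cos (PI * INR t / INR (S q)) =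
      (2 * sin (PI * INR t / INR (S q) / 2)) * (2 * sin (PI * INR t / INR (S q) / 2))).
  { intros t. set (y := PI * INR t / INR (S q) / 2).
    replace (PI * INR t / INR (S q)) with (2 * y) by (unfold y; field; lra).
    rewrite cos_2a_sin. ring. }
  rewrite (proj2 (rsum_ln_prod (fun k => 2 - 2 * cos (PI * INR k / INR (S q))) (seq 1 q)
    ltac:(intros t ht; cbv beta; specialize (P t ht); rewrite D; apply Rmult_lt_0_compat; lra))).
  rewrite <- rsum_scal. apply rsum_ext. intros t ht. specialize (P t ht).
  rewrite D, ln_mult by lra. unfold L. lra. }
rewrite <- E.
replace (2 * rsum L (seq 1 q)) with (rsum L (seq 1 q) + rsum L (seq 1 q)) by ring.
rewrite (rsum_rev L) at 2. rewrite <- rsum_plus.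
apply rsum_ext. intros t ht.
assert (hr : In (S q - t)%nat (seq 1 q)) by (apply in_seq in ht; apply in_seq; lia).
replace (1 + 1 + q - 1 - t)%nat with (S q - t)%nat by lia.
pose proof (P t ht). pose proof (P _ hr). unfold L.
rewrite <- ln_mult by lra. f_equal.
set (y := PI * INR t / INR (S q) / 2).
replace (PI * INR (S q - t) / INR (S q) / 2) with (PI / 2 - y).
- rewrite sin_shift. replace (PI * INR t / INR (S q)) with (2 * y) by (unfold y; field; lra).
  rewrite sin_2a. ring.
- apply in_seq in ht. rewrite minus_INR by lia. unfold y. field. lra.
Qed.

Lemma rsum_shift (f : nat -> R) (a k : nat) :
  rsum f (seq a k) = rsum (fun j => f (a + j)%nat) (seq 0 k).
Proof.
induction k as [|k IH]; [reflexivity|].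
rewrite !rsum_seq_S, IH. reflexivity.
Qed.

Lemma rsum_frac_blocks (b : R) (k : nat) (h u v : Z) : (0 < k)%nat ->
  (h * u + Z.of_nat k * v = 1)%Z -> Rabs (INR k * b - IZR h) <= / INR k ->
  forall B a : nat,
  Rabs (rsum (fun t => frac_part (INR t * b) - / 2) (seq a (B * k))) <= 5 / 2 * INR B.
Proof.
intros k0 bez hb. induction B as [|B IH]; intros a; [simpl; rewrite Rabs_R0; lra|].
rewrite S_INR. simpl (S B * k)%nat. rewrite seq_app, rsum_app.
eapply Rle_trans; [apply Rabs_triang|]. specialize (IH (a + k)%nat).
pose proof (rsum_frac_block (INR a * b) b k h u v k0 bez hb) as L.
rewrite rsum_shift.
rewrite (rsum_ext _ (fun j => frac_part (INR a * b + INR j * b) - / 2)); [lra|].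
intros j _. rewrite plus_INR, Rmult_plus_distr_r. reflexivity.
Qed.

Lemma rsum_frac_sqrt (b : R) (M N k : nat) (h u v : Z) : (1 <= N)%nat ->
  (Nat.sqrt N <= k <= (M + 1) * Nat.sqrt N)%nat ->
  (h * u + Z.of_nat k * v = 1)%Z -> Rabs (INR k * b - IZR h) <= / INR k ->
  Rabs (rsum (fun t => frac_part (INR t * b) - / 2) (seq 0 N)) <= (INR M + 11) * sqrt (INR N).
Proof.
intros N1 hk bez hb. set (Q := Nat.sqrt N) in *.
assert (hQ : (Q * Q <= N < S Q * S Q)%nat) by (apply Nat.sqrt_spec; lia).
assert (Q1 : (1 <= Q)%nat) by nia.
assert (k0 : (0 < k)%nat) by lia.
pose proof (Nat.div_mod N k ltac:(lia)) as dm. pose proof (Nat.mod_upper_bound N k ltac:(lia)) as mb.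
set (B := (N / k)%nat) in *. set (r := (N mod k)%nat) in *.
replace N with (B * k + r)%nat at 1 by lia. rewrite seq_app, rsum_app.
eapply Rle_trans; [apply Rabs_triang|].
pose proof (rsum_frac_blocks b k h u v k0 bez hb B 0) as L1.
assert (L2 : Rabs (rsum (fun t => frac_part (INR t * b) - / 2) (seq (0 + B * k) r)) <= INR r * / 2).
{ replace (INR r * / 2) with (rsum (fun _ => / 2) (seq (0 + B * k) r))
    by (rewrite rsum_const, length_seq; reflexivity).
  apply rsum_abs. intros t _.
  pose proof (frac_bounds (INR t * b)). apply Rabs_le. lra. }
assert (S1 : INR Q <= sqrt (INR N)).
{ rewrite <- (sqrt_square (INR Q)) by apply pos_INR. apply sqrt_le_1_alt.
  rewrite <- mult_INR. apply le_INR. lia. }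
(* N < (Q + 1)^2 <= 4 Q^2 and k >= Q. The blocks thus cost at most 10 Q, the remainder at most (M +
   1) Q / 2, together below (M + 11) Q. *)
assert (B4 : INR B <= 4 * INR Q).
{ replace 4 with (INR 4) by (simpl; lra). rewrite <- mult_INR. apply le_INR.
  apply Nat.Div0.div_le_upper_bound. nia. }
assert (R1 : INR r <= (INR M + 1) * INR Q).
{ rewrite <- S_INR, <- mult_INR. apply le_INR. lia. }
pose proof (pos_INR M). pose proof (le_INR _ _ Q1). simpl (INR 1) in H0.
assert ((INR M + 11) * INR Q <= (INR M + 11) * sqrt (INR N)) by (apply Rmult_le_compat_l; lra).
assert (0 <= INR M * INR Q) by nra.
lra.
Qed.

(* The increments of [A - c t * sqrt t - / sqrt t] dominate the terms produced by summation by parts. *)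
Lemma abel_sqrt (s c : nat -> R) (K : R) (T : nat) : 0 <= K -> (1 <= T)%nat ->
  forall m : nat,
  (forall t, (T <= t <= T + m)%nat -> Rabs (rsum s (seq 0 (S t))) <= K * sqrt (INR t)) ->
  (forall t, (T <= t <= T + m)%nat -> 0 <= c t <= / INR t) ->
  (forall t, (T <= t < T + m)%nat -> c (S t) <= c t) ->
  Rabs (rsum (fun t => c t * s t) (seq (S T) m)) <= 3 * K / sqrt (INR T).
Proof.
intros K0 T1 m hs hc hd.
assert (SQ : forall t, (1 <= t)%nat -> 0 < sqrt (INR t)).
{ intros t ht. apply sqrt_lt_R0, lt_0_INR. lia. }
assert (SS : forall t, sqrt (INR t) * sqrt (INR t) = INR t) by (intros t; apply sqrt_sqrt, pos_INR).
(* Chosen so that at i = 0 the bracket below equals c_T sqrt T, the bound for the boundary term. *)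
set (A := 2 * c T * sqrt (INR T) + / sqrt (INR T)).
set (V := fun t => rsum s (seq 0 (S t))).
assert (I : forall i, (i <= m)%nat ->
  Rabs (rsum (fun t => c t * s t) (seq (S T) i) - c (T + i)%nat * V (T + i)%nat) <=
  K * (A - c (T + i)%nat * sqrt (INR (T + i)) - / sqrt (INR (T + i)))).
{ induction i as [|i IH]; intros hi.
  - rewrite Nat.add_0_r. simpl rsum.
    replace (0 - c T * V T) with (- (c T * V T)) by ring.
    rewrite Rabs_Ropp, Rabs_mult. specialize (hs T ltac:(lia)). fold (V T) in hs.
    specialize (hc T ltac:(lia)). rewrite (Rabs_pos_eq (c T)) by lra.
    replace (K * (A - c T * sqrt (INR T) - / sqrt (INR T))) with (c T * (K * sqrt (INR T))) by (unfold A; ring).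
    apply Rmult_le_compat_l; lra.
  - specialize (IH ltac:(lia)). rewrite rsum_seq_S.
    replace (T + S i)%nat with (S (T + i)) by lia. replace (S T + i)%nat with (S (T + i)) by lia.
    set (t := (T + i)%nat) in *.
    assert (VS : V (S t) = V t + s (S t)) by (unfold V; rewrite rsum_seq_S; reflexivity).
    rewrite VS.
    replace (rsum (fun t => c t * s t) (seq (S T) i) + c (S t) * s (S t) - c (S t) * (V t + s (S t)))
      with ((rsum (fun t => c t * s t) (seq (S T) i) - c t * V t) + (c t - c (S t)) * V t) by ring.
    eapply Rle_trans; [apply Rabs_triang|]. rewrite Rabs_mult.
    specialize (hs t ltac:(lia)). fold (V t) in hs. specialize (hd t ltac:(lia)).
    rewrite (Rabs_pos_eq (c t - c (S t))) by lra.
    assert (X : (c t - c (S t)) * Rabs (V t) <= (c t - c (S t)) * (K * sqrt (INR t))) by (apply Rmult_le_compat_l; lra).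
    destruct (hc (S t) ltac:(lia)) as [c0 c1].
    pose proof (SQ t ltac:(lia)) as a0. pose proof (SQ (S t) ltac:(lia)) as b0.
    pose proof (SS t) as aa. pose proof (SS (S t)) as bb.
    set (x := sqrt (INR t)) in *. set (y := sqrt (INR (S t))) in *.
    assert (xy : x <= y) by (apply sqrt_le_1_alt, le_INR; lia).
    (* Here 1/x - 1/y = (y - x)/(x y), and c <= 1/y^2 <= 1/(x y). *)
    assert (Y : c (S t) * (y - x) <= / x - / y).
    { replace (/ x - / y) with (/ (x * y) * (y - x)) by (field; lra).
      apply Rmult_le_compat_r; [lra|]. eapply Rle_trans; [exact c1|].
      rewrite <- bb. apply Rinv_le_contravar; nra. }
    assert (Z : (c t - c (S t)) * x <= (A - c (S t) * y - / y) - (A - c t * x - / x)) by lra.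
    apply (Rmult_le_compat_l K) in Z; [|exact K0]. lra. }
specialize (I m (le_n m)). specialize (hs (T + m)%nat ltac:(lia)). fold (V (T + m)%nat) in hs.
pose proof (hc (T + m)%nat ltac:(lia)) as hcm. pose proof (hc T ltac:(lia)) as hcT.
set (X := rsum (fun t => c t * s t) (seq (S T) m)) in *.
set (cm := c (T + m)%nat) in *. set (Vm := V (T + m)%nat) in *.
replace X with ((X - cm * Vm) + cm * Vm) by ring.
eapply Rle_trans; [apply Rabs_triang|]. rewrite Rabs_mult, (Rabs_pos_eq cm) by lra.
(* The final boundary term is cancelled by the negative part of the bracket. At most K A remains,
   and c_T sqrt T <= 1/sqrt T yields the factor 3. *)
assert (cm * Rabs Vm <= cm * (K * sqrt (INR (T + m)))) by (apply Rmult_le_compat_l; lra).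
pose proof (SQ T ltac:(lia)). pose proof (SQ (T + m)%nat ltac:(lia)).
assert (0 < / sqrt (INR (T + m))) by now apply Rinv_0_lt_compat.
assert (AA : A <= 3 * / sqrt (INR T)).
{ unfold A. assert (c T * sqrt (INR T) <= / sqrt (INR T)); [|lra].
  replace (/ sqrt (INR T)) with (/ INR T * sqrt (INR T)).
  - apply Rmult_le_compat_r; lra.
  - rewrite <- (SS T) at 1. field. lra. }
assert (K * A <= K * (3 * / sqrt (INR T))) by (apply Rmult_le_compat_l; lra).
assert (0 <= K * / sqrt (INR (T + m))) by nra.
unfold Rdiv. lra.
Qed.

Lemma rsum_inv_sq (T m : nat) : (1 <= T)%nat ->
  rsum (fun t => / (INR t * INR t)) (seq (S T) m) <= / INR T - / INR (T + m).
Proof.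
intros T1. induction m as [|m IH]; [rewrite Nat.add_0_r; simpl; lra|].
rewrite rsum_seq_S. replace (S T + m)%nat with (S (T + m)) by lia.
replace (T + S m)%nat with (S (T + m)) by lia.
set (t := (T + m)%nat) in *. assert (P : 0 < INR t) by (apply lt_0_INR; lia).
rewrite !S_INR.
assert (/ ((INR t + 1) * (INR t + 1)) <= / INR t - / (INR t + 1)); [|lra].
replace (/ INR t - / (INR t + 1)) with (/ (INR t * (INR t + 1))) by (field; lra).
apply Rinv_le_contravar; nra.
Qed.

(** k {t b} lies within t/k <= 1/2 of the integer w = t h - k z. As h is invertible modulo k and 0 <
    t < k, w is no multiple of k, whence 1 <= w <= k - 1. *)
Lemma frac_away (b : R) (t k : nat) (h u v : Z) : (1 <= t)%nat -> (2 * t <= k)%nat ->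
  (h * u + Z.of_nat k * v = 1)%Z -> Rabs (INR k * b - IZR h) <= / INR k ->
  / (2 * INR k) <= frac_part (INR t * b) <= 1 - / (2 * INR k).
Proof.
intros t1 tk bez hb. pose proof (frac_bounds (INR t * b)) as F.
set (f := frac_part (INR t * b)) in *. set (z := Int_part (INR t * b)).
assert (E : INR t * b = IZR z + f) by (unfold f, frac_part, z; lra).
assert (K : 0 < INR k) by (apply lt_0_INR; lia).
assert (TP : 0 < INR t) by (apply lt_0_INR; lia).
assert (TK : 2 * INR t <= INR k).
{ replace 2 with (INR 2) by (simpl; lra). rewrite <- mult_INR. now apply le_INR. }
set (w := (Z.of_nat t * h - Z.of_nat k * z)%Z).
assert (W : IZR w = INR t * IZR h - INR k * IZR z).
{ unfold w. rewrite minus_IZR, !mult_IZR, <- !INR_IZR_INZ. reflexivity. }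
assert (D : Rabs (INR k * f - IZR w) <= / 2).
{ rewrite W. replace (INR k * f - (INR t * IZR h - INR k * IZR z)) with
    (INR t * (INR k * b - IZR h)) by (replace (INR t * (INR k * b - IZR h)) with
    (INR k * (INR t * b) - INR t * IZR h) by ring; rewrite E; ring).
  rewrite Rabs_mult, (Rabs_pos_eq (INR t)) by lra.
  apply Rle_trans with (INR t * / INR k); [apply Rmult_le_compat_l; lra|].
  apply Rmult_le_reg_r with (INR k); [lra|]. field_simplify; lra. }
apply Rabs_le_inv in D.
assert (kf : 0 <= INR k * f < INR k) by nra.
assert (w0 : (0 <= w)%Z) by (assert (-1 < w)%Z by (apply lt_IZR; lra); lia).
assert (w1 : (w <= Z.of_nat k)%Z).
{ assert (w < Z.of_nat k + 1)%Z; [|lia]. apply lt_IZR. rewrite plus_IZR, <- INR_IZR_INZ. lra. }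
assert (ND : forall y, w <> (Z.of_nat k * y)%Z).
{ intros y ey. assert (X : (Z.of_nat t = Z.of_nat k * ((y + z) * u + Z.of_nat t * v))%Z).
  { replace (Z.of_nat t) with (Z.of_nat t * (h * u + Z.of_nat k * v))%Z at 1 by (rewrite bez; ring).
    replace (Z.of_nat t * (h * u + Z.of_nat k * v))%Z with
      ((w + Z.of_nat k * z) * u + Z.of_nat k * (Z.of_nat t * v))%Z by (unfold w; ring).
    rewrite ey. ring. }
  set (Y := ((y + z) * u + Z.of_nat t * v)%Z) in *. assert (1 <= Y)%Z by nia. nia. }
pose proof (ND 0%Z). pose proof (ND 1%Z).
assert (1 <= w)%Z by lia. assert (w <= Z.of_nat k - 1)%Z by lia.
apply IZR_le in H1, H2. rewrite minus_IZR, <- INR_IZR_INZ in H2.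
assert (I : INR k * / (2 * INR k) = / 2) by (field; lra).
split; apply Rmult_le_reg_l with (INR k); try lra.
Qed.

(** * Quantitative bounds for sine, cotangent and logarithm *)

Lemma sin_cos_taylor (z : R) : 0 <= z <= 2 ->
  z - z ^ 3 / 6 <= sin z <= z /\ 1 - z ^ 2 / 2 <= cos z <= 1 - z ^ 2 / 2 + z ^ 4 / 24.
Proof.
intros hz. split.
- destruct (pre_sin_bound z 0 ltac:(lra) ltac:(lra)) as [l _].
  unfold sin_approx, sin_term in l. simpl in l.
  split; [lra|]. destruct (Req_dec z 0) as [->|n0]; [rewrite sin_0; lra|]. left. apply sin_lt_x. lra.
- destruct (pre_cos_bound z 0 ltac:(lra) ltac:(lra)) as [l r].
  unfold cos_approx, cos_term in l, r. simpl in l, r. lra.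
Qed.

Lemma sin_cos_taylor_abs (z : R) : Rabs z <= 2 ->
  Rabs (sin z) <= Rabs z /\ Rabs (sin z - z) <= z * z /\ Rabs (cos z - 1) <= z * z.
Proof.
intros hz. destruct (Rcase_abs z) as [n|p].
- rewrite (Rabs_left z) in * by lra.
  destruct (sin_cos_taylor (- z) ltac:(lra)) as [s c]. rewrite sin_neg in s. rewrite cos_neg in c.
  assert ((- z) ^ 3 / 6 <= z * z) by (simpl; nra).
  assert ((- z) ^ 3 / 6 <= - z) by (simpl; nra).
  assert (0 <= (- z) ^ 3 ) by (apply pow_le; lra).
  replace ((- z) ^ 2) with (z * z) in c by ring. replace ((- z) ^ 4) with (z * z * (z * z)) in c by ring.
  repeat split; apply Rabs_le; nra.
- rewrite (Rabs_pos_eq z) in * by lra.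
  destruct (sin_cos_taylor z ltac:(lra)) as [s c].
  assert (z ^ 3 / 6 <= z * z) by (simpl; nra).
  assert (z ^ 3 / 6 <= z) by (simpl; nra).
  assert (0 <= z ^ 3 ) by (apply pow_le; lra).
  replace (z ^ 2) with (z * z) in c by ring. replace (z ^ 4) with (z * z * (z * z)) in c by ring.
  repeat split; apply Rabs_le; nra.
Qed.

(** Both sides come from ln x <= x - 1, taken at 1 + y and at its inverse. *)
Lemma ln_one_plus (y : R) : Rabs y <= / 2 -> Rabs (ln (1 + y) - y) <= 2 * (y * y).
Proof.
intros hy. apply Rabs_le_inv in hy.
assert (U : forall x, 0 < x -> ln x <= x - 1).
{ intros x hx. rewrite <- (ln_exp (x - 1)). pose proof (exp_ineq1_le (x - 1)).
  assert (x <= exp (x - 1)) as [l | <-] by lra; [left; now apply ln_increasing | lra]. }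
pose proof (U (1 + y) ltac:(lra)) as u1.
pose proof (U (/ (1 + y)) ltac:(apply Rinv_0_lt_compat; lra)) as u2.
rewrite ln_Rinv in u2 by lra.
assert (/ (1 + y) - 1 <= - y + 2 * (y * y)).
{ apply Rmult_le_reg_r with (1 + y); [lra|]. field_simplify; [|lra]. nra. }
apply Rabs_le. nra.
Qed.

Lemma cot_le_inv (a : R) : 0 < a <= PI / 2 -> 0 <= cos a / sin a <= / a.
Proof.
intros ha. pose proof PI_4. pose proof (cos_ge_0 a ltac:(lra) ltac:(lra)).
pose proof (sin_gt_0 a ltac:(lra) ltac:(lra)).
split; [apply Rle_mult_inv_pos; lra|].
apply Rmult_le_reg_r with (a * sin a); [nra|]. field_simplify; try lra.
destruct (sin_cos_taylor a ltac:(lra)) as [s c].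
assert (a * cos a <= a * (1 - a ^ 2 / 2 + a ^ 4 / 24)) by (apply Rmult_le_compat_l; lra).
(* The Taylor bounds reduce a cos a <= sin a to a^5/24 <= a^3/3. *)
assert (0 <= a ^ 3 * (8 - a ^ 2)) by (apply Rmult_le_pos; [apply pow_le; lra| nra]).
nra.
Qed.

Lemma cot_antitone (a b : R) : 0 < a -> a <= b -> b < PI -> cos b / sin b <= cos a / sin a.
Proof.
intros ha hab hb.
pose proof (sin_gt_0 a ltac:(lra) ltac:(lra)). pose proof (sin_gt_0 b ltac:(lra) ltac:(lra)).
assert (0 <= cos a / sin a - cos b / sin b); [|lra].
replace (cos a / sin a - cos b / sin b) with (sin (b - a) / (sin a * sin b)).
- apply Rle_mult_inv_pos; [apply sin_ge_0; lra | nra].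
- rewrite sin_minus. field. lra.
Qed.

(** The ratio is cos z - cot a sin z = 1 + y, where y equals - z cot a up to 6/t^2, because |z| <=
    2/t and |z| cot a <= 1/t. From 5 <= t one gets |y| <= 11/(5 t) < 1/2, so [ln_one_plus] applies,
    and 6 + 2 (11/5)^2 < 16. *)
Lemma ln_sin_ratio (a z t : R) : 5 <= t -> 0 < a <= PI / 2 -> Rabs z <= a / t ->
  Rabs (ln (sin (a - z) / sin a) + z * (cos a / sin a)) <= 16 / (t * t).
Proof.
intros ht ha hz. destruct (cot_le_inv a ha) as [c0 c1].
pose proof (sin_gt_0 a ltac:(lra) ltac:(lra)) as sa.
set (c := cos a / sin a) in *. pose proof PI_4 as P4.
set (i := / t). assert (i0 : 0 < i <= / 5) by (unfold i; split; [apply Rinv_0_lt_compat; lra|apply Rinv_le_contravar; lra]).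
replace (a / t) with (a * i) in hz by reflexivity.
replace (16 / (t * t)) with (16 * (i * i)) by (unfold i; field; lra).
pose proof (Rabs_pos z) as z0.
assert (z2 : Rabs z <= 2 * i) by nra.
destruct (sin_cos_taylor_abs z ltac:(nra)) as [s1 [s2 s3]].
assert (zz : z * z = Rabs z * Rabs z) by (rewrite <- Rabs_mult; symmetry; apply Rabs_pos_eq; nra).
assert (cz : c * Rabs z <= i).
{ apply Rle_trans with (/ a * (a * i)); [apply Rmult_le_compat; lra|]. right. field. lra. }
set (y := (cos z - 1) - c * sin z).
assert (E : sin (a - z) / sin a = 1 + y) by (unfold y, c; rewrite sin_minus; field; lra).
assert (czz : c * (z * z) <= 2 * (i * i)) by (rewrite zz; nra).
assert (Y1 : Rabs (y + z * c) <= 4 * (i * i) + 2 * (i * i)).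
{ replace (y + z * c) with ((cos z - 1) + - (c * (sin z - z))) by (unfold y; ring).
  eapply Rle_trans; [apply Rabs_triang|]. rewrite Rabs_Ropp, Rabs_mult, (Rabs_pos_eq c) by lra.
  assert (c * Rabs (sin z - z) <= c * (z * z)) by (apply Rmult_le_compat_l; lra).
  nra. }
assert (zc : Rabs (z * c) <= i) by (rewrite Rabs_mult, (Rabs_pos_eq c) by lra; lra).
apply Rabs_le_inv in Y1, zc.
assert (Y2 : Rabs y <= / 2) by (apply Rabs_le; nra).
pose proof (ln_one_plus y Y2) as L. apply Rabs_le_inv in L.
assert (Y3 : y * y <= (i + 6 * (i * i)) * (i + 6 * (i * i))) by nra.
assert (Y4 : y * y <= (11 / 5 * i) * (11 / 5 * i)).
{ eapply Rle_trans; [exact Y3|]. apply Rmult_le_compat; nra. }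
rewrite E. apply Rabs_le. lra.
Qed.

Lemma Rabs_sin_add_IZR_PI (x : R) (w : Z) : Rabs (sin (x + IZR w * PI)) = Rabs (sin x).
Proof.
assert (s : sin (IZR w * PI) = 0) by (apply sin_eq_0_1; eauto).
pose proof (sin2_cos2 (IZR w * PI)) as c. rewrite s in c. unfold Rsqr in c.
rewrite sin_plus, s, Rmult_0_r, Rplus_0_r, Rabs_mult.
assert (Rabs (cos (IZR w * PI)) = 1); [|nra].
pose proof (Rabs_pos (cos (IZR w * PI))).
assert (Rabs (cos (IZR w * PI)) * Rabs (cos (IZR w * PI)) = 1); [|nra].
rewrite <- Rabs_mult. replace (cos (IZR w * PI) * cos (IZR w * PI)) with 1 by lra. apply Rabs_R1.
Qed.

Lemma sin_frac_pos (x q : R) : 0 < x < q -> 0 < sin (PI * x / q).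
Proof.
intros hx. pose proof PI_RGT_0. apply sin_gt_0.
- apply Rdiv_lt_0_compat; nra.
- apply Rmult_lt_reg_r with q; [lra|]. field_simplify; nra.
Qed.

(** * Convergents for an arbitrary coefficient sequence *)

(** [cont b 0 1] lists the denominators and [cont b 1 0] the numerators of the convergents of
    [0; b_1, b_2, ...]. The sequence [b] is free because both the coefficients of alpha and their
    reversal are substituted. *)
Fixpoint cont (b : nat -> nat) (u v : Z) (n : nat) : Z :=
  match n with
  | O => u
  | S m => match m with
           | O => v
           | S l => (Z.of_nat (b m) * cont b u v m + cont b u v l)%Z
           end
  end.

Lemma cont_SS (b : nat -> nat) (u v : Z) (n : nat) :
  cont b u v (S (S n)) = (Z.of_nat (b (S n)) * cont b u v (S n) + cont b u v n)%Z.
Proof. reflexivity. Qed.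

Definition sign_pow (n : nat) : Z := if Nat.even n then 1%Z else (-1)%Z.

Lemma sign_pow_S (n : nat) : sign_pow (S n) = (- sign_pow n)%Z.
Proof. unfold sign_pow. rewrite Nat.even_succ, <- Nat.negb_even. destruct (Nat.even n); reflexivity. Qed.

Lemma sign_pow_cases (n : nat) : sign_pow n = 1%Z \/ sign_pow n = (-1)%Z.
Proof. unfold sign_pow. destruct (Nat.even n); auto. Qed.

Lemma cont_det (b : nat -> nat) (n : nat) :
  (cont b 1 0 n * cont b 0 1 (S n) - cont b 1 0 (S n) * cont b 0 1 n = sign_pow n)%Z.
Proof.
induction n as [|n IH]; [reflexivity|].
rewrite sign_pow_S, <- IH, !cont_SS. ring.
Qed.

Lemma cont_den_bounds (b : nat -> nat) (m : nat) :
  (forall j, (1 <= j <= m)%nat -> (1 <= b j)%nat) ->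
  forall j, (j <= m)%nat -> (0 <= cont b 0 1 j <= cont b 0 1 (S j) /\ 1 <= cont b 0 1 (S j))%Z.
Proof.
intros hb. induction j as [|j IH]; intros hj; [simpl; lia|].
rewrite cont_SS. specialize (hb (S j) ltac:(lia)). specialize (IH ltac:(lia)). nia.
Qed.

(** [rho j] plays the tail [0; b_{j+1}, ...], and rho_0 is a Moebius transform of rho_j, written
    without division. Restricting the relation to j < m admits terminating expansions, whose last
    tail is 0. *)
Lemma cont_remainder (b : nat -> nat) (rho : nat -> R) (m : nat) :
  (forall j, (j < m)%nat -> rho j * (INR (b (S j)) + rho (S j)) = 1) ->
  forall j, (j <= m)%nat ->
  rho O * (IZR (cont b 0 1 (S j)) + rho j * IZR (cont b 0 1 j)) =
  IZR (cont b 1 0 (S j)) + rho j * IZR (cont b 1 0 j).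
Proof.
intros hr. induction j as [|j IH]; intros hj; [simpl; lra|].
specialize (IH ltac:(lia)). specialize (hr j ltac:(lia)).
assert (rho j <> 0) by (intros z; rewrite z in hr; lra).
rewrite !cont_SS, !plus_IZR, !mult_IZR, <- !INR_IZR_INZ.
apply Rmult_eq_reg_l with (rho j); [|assumption].
set (D1 := IZR (cont b 0 1 (S j))) in *. set (D0 := IZR (cont b 0 1 j)) in *.
set (N1 := IZR (cont b 1 0 (S j))) in *. set (N0 := IZR (cont b 1 0 j)) in *.
replace (rho j * (rho 0%nat * (INR (b (S j)) * D1 + D0 + rho (S j) * D1))) with
  (rho 0%nat * (rho j * (INR (b (S j)) + rho (S j)) * D1 + rho j * D0)) by ring.
replace (rho j * (INR (b (S j)) * N1 + N0 + rho (S j) * N1)) with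
  (rho j * (INR (b (S j)) + rho (S j)) * N1 + rho j * N0) by ring.
rewrite hr. lra.
Qed.

Lemma cont_error (b : nat -> nat) (rho : nat -> R) (m : nat) :
  (forall j, (j < m)%nat -> rho j * (INR (b (S j)) + rho (S j)) = 1) ->
  (forall j, (1 <= j <= m)%nat -> (1 <= b j)%nat) ->
  forall j, (j <= m)%nat -> 0 <= rho j ->
  IZR (cont b 0 1 (S j)) * rho O - IZR (cont b 1 0 (S j)) =
  IZR (sign_pow j) * (rho j / (IZR (cont b 0 1 (S j)) + rho j * IZR (cont b 0 1 j))).
Proof.
intros hr hb j hj r0. pose proof (cont_remainder b rho m hr j hj) as e.
destruct (cont_den_bounds b m hb j hj) as [[d0 _] d1]. apply IZR_le in d0, d1.
rewrite <- (cont_det b j), minus_IZR, !mult_IZR.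
set (D1 := IZR (cont b 0 1 (S j))) in *. set (D0 := IZR (cont b 0 1 j)) in *.
set (N1 := IZR (cont b 1 0 (S j))) in *. set (N0 := IZR (cont b 1 0 j)) in *.
assert (0 <= rho j * D0) by nra.
apply Rmult_eq_reg_r with (D1 + rho j * D0); [|lra].
replace ((D1 * rho 0%nat - N1) * (D1 + rho j * D0)) with
  (D1 * (rho 0%nat * (D1 + rho j * D0)) - N1 * (D1 + rho j * D0)) by ring.
rewrite e. field. lra.
Qed.

(** Take the first denominator that reaches Q: its predecessors are below Q, so one step of the
    recurrence keeps it at most (M + 1) Q. The determinant provides the Bezout coefficients,
    [cont_error] the approximation. *)
Lemma cont_select (b : nat -> nat) (rho : nat -> R) (M m : nat) :
  (forall j, (j < m)%nat -> rho j * (INR (b (S j)) + rho (S j)) = 1) ->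
  (forall j, (1 <= j <= m)%nat -> (1 <= b j <= M)%nat) ->
  (forall j, (j <= m)%nat -> 0 <= rho j <= 1) ->
  forall Q : nat, (1 <= Q)%nat -> (Z.of_nat Q <= cont b 0 1 (S m))%Z ->
  exists (k : nat) (h u v : Z), (Q <= k <= (M + 1) * Q)%nat /\
    (h * u + Z.of_nat k * v = 1)%Z /\ Rabs (INR k * rho O - IZR h) <= / INR k.
Proof.
intros hr hb hrho Q Q1.
assert (W : forall j, (j <= m)%nat -> (Z.of_nat Q <= cont b 0 1 (S j))%Z ->
  (cont b 0 1 (S j) <= (Z.of_nat M + 1) * Z.of_nat Q)%Z ->
  exists (k : nat) (h u v : Z), (Q <= k <= (M + 1) * Q)%nat /\
    (h * u + Z.of_nat k * v = 1)%Z /\ Rabs (INR k * rho O - IZR h) <= / INR k).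
{ intros j hj l1 l2.
  exists (Z.to_nat (cont b 0 1 (S j))), (cont b 1 0 (S j)),
    (- sign_pow j * cont b 0 1 j)%Z, (sign_pow j * cont b 1 0 j)%Z.
  assert (hb' : forall j, (1 <= j <= m)%nat -> (1 <= b j)%nat) by (intros i hi; apply hb in hi; lia).
  destruct (cont_den_bounds b m hb' j hj) as [[d0 d01] d1].
  split; [lia|]. rewrite Z2Nat.id by lia. split.
  - pose proof (cont_det b j). destruct (sign_pow_cases j) as [e|e]; rewrite e in *; lia.
  - rewrite INR_IZR_INZ, Z2Nat.id by lia.
    rewrite (cont_error b rho m hr hb' j hj (proj1 (hrho j hj))).
    specialize (hrho j hj). apply IZR_le in d0, d1.
    set (D1 := IZR (cont b 0 1 (S j))) in *. set (D0 := IZR (cont b 0 1 j)) in *.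
    assert (0 <= rho j * D0) by nra.
    assert (B : 0 <= rho j / (D1 + rho j * D0) <= / D1).
    { split; [apply Rle_mult_inv_pos; lra|].
      apply Rmult_le_reg_r with (D1 * (D1 + rho j * D0)); [nra|].
      field_simplify; nra. }
    apply Rabs_le. destruct (sign_pow_cases j) as [e|e]; rewrite e; lra. }
assert (I : forall j, (j <= m)%nat -> (Z.of_nat Q <= cont b 0 1 (S j))%Z ->
  exists (k : nat) (h u v : Z), (Q <= k <= (M + 1) * Q)%nat /\
    (h * u + Z.of_nat k * v = 1)%Z /\ Rabs (INR k * rho O - IZR h) <= / INR k).
{ induction j as [|j IH]; intros hj l.
  - apply (W O hj l). change (cont b 0 1 1) with 1%Z. nia.
  - destruct (Z_le_gt_dec (Z.of_nat Q) (cont b 0 1 (S j))) as [l'|g]; [apply IH; auto; lia|].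
    apply (W (S j) hj l). rewrite cont_SS.
    assert (hb' : forall j, (1 <= j <= m)%nat -> (1 <= b j)%nat) by (intros i hi; apply hb in hi; lia).
    destruct (cont_den_bounds b m hb' j ltac:(lia)) as [[d0 d01] d1].
    specialize (hb (S j) ltac:(lia)). nia. }
intros hQ. apply (I m); auto.
Qed.

(** * The continued fraction of alpha and the reindexed product *)

Section Alpha.
Variable alpha : R.
Hypothesis alpha01 : 0 < alpha < 1.
Hypothesis alpha_irr : irrational alpha.

(** Irrationality is carried through the induction because it excludes x_{n+1} = 0, that is, a
    terminating expansion. *)
Lemma gauss_irr (n : nat) : 0 < gauss_iter alpha n < 1 /\ irrational (gauss_iter alpha n).
Proof.
induction n as [|n [r irr]]; [now split|]. simpl.
set (y := gauss_iter alpha n) in *. set (k := Int_part (/ y)).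
assert (I : irrational (/ y - IZR k)).
{ intros (p & q & q0 & e).
  assert (Q : IZR q <> 0) by (intros z; apply q0, eq_IZR, z).
  assert (e' : / y = (IZR p + IZR k * IZR q) / IZR q).
  { replace (/ y) with (IZR p / IZR q + IZR k) by lra. field. exact Q. }
  apply irr. exists q, (p + k * q)%Z.
  assert (X : IZR p + IZR k * IZR q <> 0).
  { intros z. rewrite z in e'. assert (0 < / y) by (apply Rinv_0_lt_compat; lra).
    unfold Rdiv in e'. lra. }
  split; [intros z; apply X; rewrite <- mult_IZR, <- plus_IZR, z; reflexivity|].
  rewrite plus_IZR, mult_IZR. rewrite <- (Rinv_inv y), e'. field. auto. }
split; [|exact I].
pose proof (base_Int_part (/ y)). fold k in H.
assert (/ y - IZR k <> 0); [|lra].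
intros z. apply I. exists 0%Z, 1%Z. split; [lia|]. lra.
Qed.

Lemma gauss_step (n : nat) :
  (1 <= cf_a alpha (S n))%nat /\
  gauss_iter alpha n * (INR (cf_a alpha (S n)) + gauss_iter alpha (S n)) = 1.
Proof.
destruct (gauss_irr n) as [r _]. simpl. set (y := gauss_iter alpha n) in *.
assert (L : 1 < / y) by (rewrite <- Rinv_1; apply Rinv_lt_contravar; lra).
pose proof (base_Int_part (/ y)) as B.
assert (K : (1 <= Int_part (/ y))%Z).
{ assert (0 < Int_part (/ y))%Z by (apply lt_IZR; lra). lia. }
split; [lia|].
rewrite INR_IZR_INZ, Z2Nat.id by lia. field. lra.
Qed.

Lemma alpha_plus_gauss (n : nat) : alpha_plus alpha (S n) = / gauss_iter alpha n.
Proof.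
unfold alpha_plus. destruct (gauss_step n) as [_ e]. destruct (gauss_irr n) as [r _].
apply Rmult_eq_reg_l with (gauss_iter alpha n); [|lra]. rewrite e. field. lra.
Qed.

Lemma cf_q_cont (n : nat) : Z.of_nat (cf_q alpha n) = cont (cf_a alpha) 0 1 n.
Proof.
assert (H : forall m, Z.of_nat (fst (qpair alpha m)) = cont (cf_a alpha) 0 1 m /\
   Z.of_nat (snd (qpair alpha m)) = cont (cf_a alpha) 0 1 (S m)).
{ induction m as [|m [h1 h2]]; [split; reflexivity|].
  cbn [qpair]. destruct (qpair alpha m) as [x y]. cbn [fst snd] in *.
  split; [exact h2|]. rewrite cont_SS. lia. }
apply H.
Qed.

Lemma cf_q_SS (n : nat) :
  cf_q alpha (S (S n)) = (cf_a alpha (S n) * cf_q alpha (S n) + cf_q alpha n)%nat.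
Proof. apply Nat2Z.inj. rewrite Nat2Z.inj_add, Nat2Z.inj_mul, !cf_q_cont, cont_SS. reflexivity. Qed.

Lemma cf_q_pos (n : nat) : (1 <= cf_q alpha (S n))%nat.
Proof.
destruct (cont_den_bounds (cf_a alpha) n) with (j := n) as [_ h]; [|lia|].
- intros j hj. destruct j as [|j]; [lia|]. apply gauss_step.
- rewrite <- cf_q_cont in h. lia.
Qed.

(** The offset 1 is due to q_1 = q_2 = 1 when a_1 = 1. Two consecutive indices are carried since the
    recurrence has order two. *)
Lemma cf_q_ge (n : nat) : (n <= S (cf_q alpha n))%nat.
Proof.
assert (H : (n <= S (cf_q alpha n) /\ S n <= S (cf_q alpha (S n)))%nat); [|apply H].
induction n as [|n [h1 h2]]; [pose proof (cf_q_pos 0); lia|].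
split; [exact h2|]. rewrite cf_q_SS.
pose proof (proj1 (gauss_step n)). pose proof (cf_q_pos n).
destruct n as [|n]; [change (cf_q alpha 0) with O; nia|].
pose proof (cf_q_pos n). nia.
Qed.

Lemma alpha_minus_SS (n : nat) :
  alpha_minus alpha (S (S n)) = / (INR (cf_a alpha (S n)) + alpha_minus alpha (S n)).
Proof. reflexivity. Qed.

Lemma alpha_minus_bounds (n : nat) : 0 <= alpha_minus alpha n <= 1.
Proof.
destruct n as [|n]; [simpl; lra|].
induction n as [|n IH]; [simpl; lra|]. rewrite alpha_minus_SS.
pose proof (le_INR _ _ (proj1 (gauss_step n))). simpl (INR 1) in H.
split; [left; apply Rinv_0_lt_compat; lra|].
rewrite <- Rinv_1. apply Rinv_le_contravar; lra.
Qed.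

Lemma alpha_minus_ratio (n : nat) :
  alpha_minus alpha (S n) = INR (cf_q alpha n) / INR (cf_q alpha (S n)).
Proof.
induction n as [|n IH]; [simpl; lra|].
rewrite alpha_minus_SS, IH, cf_q_SS, plus_INR, mult_INR.
pose proof (le_INR _ _ (cf_q_pos n)). simpl (INR 1) in H.
pose proof (le_INR _ _ (proj1 (gauss_step n))). simpl (INR 1) in H0.
pose proof (pos_INR (cf_q alpha n)).
field. repeat split; nra.
Qed.

(* [q_n |q_n alpha - p_n|] *)
Definition scaled_dist (n : nat) : R := / (alpha_plus alpha n + alpha_minus alpha n).

Lemma scaled_dist_bounds (n : nat) : 0 < scaled_dist (S n) < 1.
Proof.
unfold scaled_dist. rewrite alpha_plus_gauss. destruct (gauss_irr n) as [r _].
pose proof (alpha_minus_bounds (S n)).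
assert (L : 1 < / gauss_iter alpha n) by (rewrite <- Rinv_1; apply Rinv_lt_contravar; lra).
split; [apply Rinv_0_lt_compat; lra|].
rewrite <- Rinv_1. apply Rinv_lt_contravar; lra.
Qed.

(** [p] and [p'] are consecutive numerators. A single sign [e] governs both the determinant and the
    side of the error, which is why it disappears under |sin|. *)
Lemma cf_approx (n : nat) : exists p p' e : Z, (e = 1 \/ e = -1)%Z /\
  (p * Z.of_nat (cf_q alpha n) = e + Z.of_nat (cf_q alpha (S n)) * p')%Z /\
  INR (cf_q alpha (S n)) * alpha = IZR p - IZR e * (scaled_dist (S n) / INR (cf_q alpha (S n))).
Proof.
exists (cont (cf_a alpha) 1 0 (S n)), (cont (cf_a alpha) 1 0 n), (- sign_pow n)%Z.
split; [|split].
- destruct (sign_pow_cases n) as [e|e]; rewrite e; lia.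
- pose proof (cont_det (cf_a alpha) n). rewrite !cf_q_cont. lia.
- pose proof (cont_error (cf_a alpha) (gauss_iter alpha) n
    (fun j _ => proj2 (gauss_step j))) as E.
  specialize (E ltac:(intros j hj; destruct j as [|j]; [lia|]; apply gauss_step) n (le_n n)).
  destruct (gauss_irr n) as [r _]. specialize (E ltac:(lra)).
  rewrite <- !cf_q_cont, <- !INR_IZR_INZ in E. change (gauss_iter alpha 0) with alpha in E.
  rewrite opp_IZR.
  assert (scaled_dist (S n) / INR (cf_q alpha (S n)) =
    gauss_iter alpha n / (INR (cf_q alpha (S n)) + gauss_iter alpha n * INR (cf_q alpha n))) as L; [|rewrite L; lra].
  unfold scaled_dist. rewrite alpha_plus_gauss, alpha_minus_ratio.
  pose proof (le_INR _ _ (cf_q_pos n)). simpl (INR 1) in H.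
  pose proof (pos_INR (cf_q alpha n)).
  set (D1 := INR (cf_q alpha (S n))) in *. set (D0 := INR (cf_q alpha n)) in *.
  set (y := gauss_iter alpha n) in *. assert (0 <= y * D0) by nra.
  field. repeat split; lra.
Qed.

(** The tails of alpha_n^- are the alpha_j^- of lower index, so [cont_select] applies to the
    coefficients read backwards, ending in the tail alpha_1^- = 0. *)
Lemma alpha_minus_select (M n Q : nat) :
  (forall k : nat, (1 <= k)%nat -> (cf_a alpha k <= M)%nat) ->
  (1 <= Q <= cf_q alpha (S n))%nat ->
  exists (k : nat) (h u v : Z), (Q <= k <= (M + 1) * Q)%nat /\
    (h * u + Z.of_nat k * v = 1)%Z /\ Rabs (INR k * alpha_minus alpha (S n) - IZR h) <= / INR k.
Proof.
intros hM hQ.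
set (b := fun j => cf_a alpha (S n - j)). set (rho := fun j => alpha_minus alpha (S n - j)).
assert (hr : forall j, (j < n)%nat -> rho j * (INR (b (S j)) + rho (S j)) = 1).
{ intros j hj. unfold rho, b. replace (S n - j)%nat with (S (S (n - S j))) by lia.
  replace (S n - S j)%nat with (S (n - S j)) by lia. rewrite alpha_minus_SS.
  pose proof (le_INR _ _ (proj1 (gauss_step (n - S j)))). simpl (INR 1) in H.
  pose proof (alpha_minus_bounds (S (n - S j))). field. lra. }
assert (hb : forall j, (1 <= j <= n)%nat -> (1 <= b j <= M)%nat).
{ intros j hj. unfold b. split; [|apply hM; lia].
  replace (S n - j)%nat with (S (n - j)) by lia. apply gauss_step. }
change (alpha_minus alpha (S n)) with (rho O).
apply (cont_select b rho M n hr hb (fun j _ => alpha_minus_bounds _)); [lia|].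
assert (hb' : forall j, (1 <= j <= n)%nat -> (1 <= b j)%nat) by (intros i hi; apply hb in hi; lia).
pose proof (cont_remainder b rho n hr n (le_n n)) as E.
destruct (cont_den_bounds b n hb' n (le_n n)) as [_ D].
assert (Z0 : rho n = 0) by (unfold rho; replace (S n - n)%nat with 1%nat by lia; reflexivity).
rewrite Z0, !Rmult_0_l, !Rplus_0_r in E.
change (rho O) with (alpha_minus alpha (S n)) in E. rewrite alpha_minus_ratio in E.
pose proof (cf_q_pos n) as q1. pose proof (le_INR _ _ q1) as q1R. simpl (INR 1) in q1R.
(* It remains to see that the last reversed denominator [D1] reaches [cf_q alpha (S n)]. Both
   fractions represent the same number and the second is in lowest terms, so [cf_q alpha (S n)]
   divides [D1] >= 1. *)
assert (E' : (Z.of_nat (cf_q alpha n) * cont b 0 1 (S n) = Z.of_nat (cf_q alpha (S n)) * cont b 1 0 (S n))%Z).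
{ apply eq_IZR. rewrite !mult_IZR, <- !INR_IZR_INZ, <- E. field. lra. }
destruct (cf_approx n) as (p & p' & e & he & det & _).
set (D1 := cont b 0 1 (S n)) in *. set (N1 := cont b 1 0 (S n)) in *.
assert (F : (e * D1 = Z.of_nat (cf_q alpha (S n)) * (p * N1 - p' * D1))%Z).
{ replace e with (p * Z.of_nat (cf_q alpha n) - Z.of_nat (cf_q alpha (S n)) * p')%Z by lia.
  replace ((p * Z.of_nat (cf_q alpha n) - Z.of_nat (cf_q alpha (S n)) * p') * D1)%Z with
    (p * (Z.of_nat (cf_q alpha n) * D1) - Z.of_nat (cf_q alpha (S n)) * p' * D1)%Z by ring.
  rewrite E'. ring. }
set (w := (p * N1 - p' * D1)%Z) in *.
assert (Z.of_nat (cf_q alpha (S n)) <= D1)%Z; [|lia].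
destruct he as [-> | ->]; [assert (1 <= w)%Z by nia | assert (w <= -1)%Z by nia]; nia.
Qed.

Lemma sin_alpha_neq0 (r : nat) : sin (PI * INR (S r) * alpha) <> 0.
Proof.
intros z. apply sin_eq_0_0 in z. destruct z as [w e]. pose proof PI_RGT_0.
apply alpha_irr. exists w, (Z.of_nat (S r)). split; [lia|].
rewrite <- INR_IZR_INZ. assert (0 < INR (S r)) by (apply lt_0_INR; lia).
apply Rmult_eq_reg_l with (PI * INR (S r)); [|nra]. rewrite e. field. lra.
Qed.

Lemma ln_sine_prod (N : nat) : 0 < sine_prod N alpha /\
  ln (sine_prod N alpha) = rsum (fun r => ln (Rabs (2 * sin (PI * INR r * alpha)))) (seq 1 N).
Proof.
induction N as [|N [p e]]; [simpl; rewrite ln_1; lra|].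
assert (0 < Rabs (2 * sin (PI * INR (S N) * alpha))).
{ apply Rabs_pos_lt. pose proof (sin_alpha_neq0 N). lra. }
rewrite rsum_seq_S. cbn [sine_prod]. split; [nra|].
rewrite ln_mult, e by assumption. reflexivity.
Qed.

Definition theta (n t : nat) : R := frac_part (INR t * alpha_minus alpha n).

(** By [cf_approx], r p = e t modulo q, while r alpha = r p/q - e lam (r/q)/q with r/q = theta.
    Hence r alpha = e (t - lam theta)/q modulo 1. The leading [0 +] matches the index in
    [rsum_affine_mod]. *)
Lemma sin_orbit (n t : nat) :
  let q := cf_q alpha (S n) in
  let r := Z.to_nat ((0 + Z.of_nat t * Z.of_nat (cf_q alpha n)) mod Z.of_nat q) in
  theta (S n) t = INR r / INR q /\
  Rabs (sin (PI * INR r * alpha)) = Rabs (sin (PI * (INR t - scaled_dist (S n) * theta (S n) t) / INR q)).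
Proof.
intros q r. pose proof (cf_q_pos n) as q1. fold q in q1.
pose proof (le_INR _ _ q1) as Q. simpl (INR 1) in Q.
pose proof (Z.mod_pos_bound (0 + Z.of_nat t * Z.of_nat (cf_q alpha n)) (Z.of_nat q) ltac:(lia)) as mb.
pose proof (Z.div_mod (0 + Z.of_nat t * Z.of_nat (cf_q alpha n)) (Z.of_nat q) ltac:(lia)) as dm.
set (z := ((0 + Z.of_nat t * Z.of_nat (cf_q alpha n)) / Z.of_nat q)%Z) in *.
assert (hr : Z.of_nat r = ((0 + Z.of_nat t * Z.of_nat (cf_q alpha n)) mod Z.of_nat q)%Z) by (unfold r; lia).
rewrite <- hr in *.
assert (th : theta (S n) t = INR r / INR q).
{ apply (frac_unique _ _ z).
  - rewrite alpha_minus_ratio. fold q. apply (f_equal IZR) in dm.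
    rewrite !plus_IZR, !mult_IZR, <- !INR_IZR_INZ in dm.
    apply Rmult_eq_reg_r with (INR q); [|lra]. field_simplify; lra.
  - assert (INR r < INR q) by (apply lt_INR; lia). pose proof (pos_INR r).
    split; [apply Rle_mult_inv_pos; lra|]. apply Rmult_lt_reg_r with (INR q); [lra|]. field_simplify; lra. }
split; [exact th|].
destruct (cf_approx n) as (p & p' & e & he & det & app). fold q in det, app.
assert (W : (Z.of_nat r * p = e * Z.of_nat t + Z.of_nat q * (Z.of_nat t * p' - z * p))%Z).
{ replace (Z.of_nat r) with (Z.of_nat t * Z.of_nat (cf_q alpha n) - Z.of_nat q * z)%Z by lia.
  replace ((Z.of_nat t * Z.of_nat (cf_q alpha n) - Z.of_nat q * z) * p)%Z with
    (Z.of_nat t * (p * Z.of_nat (cf_q alpha n)) - Z.of_nat q * z * p)%Z by ring.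
  rewrite det. ring. }
set (w := (Z.of_nat t * p' - z * p)%Z) in *.
apply (f_equal IZR) in W. rewrite !plus_IZR, !mult_IZR, <- !INR_IZR_INZ in W.
set (x := PI * (INR t - scaled_dist (S n) * theta (S n) t) / INR q).
replace (PI * INR r * alpha) with (IZR e * x + IZR w * PI).
- rewrite Rabs_sin_add_IZR_PI. destruct he as [-> | ->].
  + rewrite Rmult_1_l. reflexivity.
  + replace (IZR (-1) * x) with (- x) by (simpl; ring). rewrite sin_neg, Rabs_Ropp. reflexivity.
- unfold x. rewrite th.
  apply Rmult_eq_reg_r with (INR q); [|lra].
  replace (PI * INR r * alpha * INR q) with (PI * INR r * (INR q * alpha)) by ring.
  rewrite app.
  replace (PI * INR r * (IZR p - IZR e * (scaled_dist (S n) / INR q))) with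
    (PI * (INR r * IZR p) - PI * INR r * IZR e * (scaled_dist (S n) / INR q)) by ring.
  rewrite W. field. lra.
Qed.

(** q alpha_minus is an integer, so the reflection negates t alpha_minus modulo 1. The exceptional
    value theta = 0 would make q divide t. *)
Lemma theta_rev (n t : nat) : (1 <= t < cf_q alpha (S n))%nat ->
  theta (S n) (cf_q alpha (S n) - t) = 1 - theta (S n) t.
Proof.
intros ht. set (q := cf_q alpha (S n)) in *.
pose proof (frac_bounds (INR t * alpha_minus alpha (S n))) as F. fold (theta (S n) t) in F.
set (z := Int_part (INR t * alpha_minus alpha (S n))).
assert (E : INR t * alpha_minus alpha (S n) = IZR z + theta (S n) t) by (unfold theta, frac_part, z; lra).
pose proof (cf_q_pos n) as q1. fold q in q1.
pose proof (le_INR _ _ q1) as Q. simpl (INR 1) in Q.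
rewrite alpha_minus_ratio in E. fold q in E.
assert (N0 : theta (S n) t <> 0).
{ intros th. rewrite th, Rplus_0_r in E.
  assert (D : (Z.of_nat t * Z.of_nat (cf_q alpha n) = Z.of_nat q * z)%Z).
  { apply eq_IZR. rewrite !mult_IZR, <- !INR_IZR_INZ, <- E. field. lra. }
  destruct (cf_approx n) as (p & p' & e & he & det & _). fold q in det.
  assert (X : (e * Z.of_nat t = Z.of_nat q * (p * z - Z.of_nat t * p'))%Z).
  { replace e with (p * Z.of_nat (cf_q alpha n) - Z.of_nat q * p')%Z by lia.
    replace ((p * Z.of_nat (cf_q alpha n) - Z.of_nat q * p') * Z.of_nat t)%Z with
      (p * (Z.of_nat t * Z.of_nat (cf_q alpha n)) - Z.of_nat q * p' * Z.of_nat t)%Z by ring.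
    rewrite D. ring. }
  set (y := (p * z - Z.of_nat t * p')%Z) in *.
  destruct he as [-> | ->]; [assert (1 <= y)%Z by nia | assert (y <= -1)%Z by nia]; nia. }
apply (frac_unique _ _ (Z.of_nat (cf_q alpha n) - z - 1)); [|lra].
rewrite minus_INR, !minus_IZR, <- INR_IZR_INZ, alpha_minus_ratio by lia. fold q.
replace ((INR q - INR t) * (INR (cf_q alpha n) / INR q)) with
  (INR (cf_q alpha n) - INR t * (INR (cf_q alpha n) / INR q)) by (field; lra).
rewrite E. lra.
Qed.

Definition shifted (n t : nat) : R := INR t - scaled_dist n * theta n t.

Lemma shifted_bounds (n t : nat) : (1 <= t)%nat ->
  0 < shifted (S n) t <= INR t.
Proof.
intros ht. apply le_INR in ht. simpl (INR 1) in ht. pose proof (scaled_dist_bounds n).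
pose proof (frac_bounds (INR t * alpha_minus alpha (S n))) as F. fold (theta (S n) t) in F.
unfold shifted. nra.
Qed.

Definition log_factor (n t : nat) : R :=
  ln (sin (PI * shifted n t / INR (cf_q alpha n)) / sin (PI * INR t / INR (cf_q alpha n))).

Lemma ln_sine_prod_q (n : nat) :
  let q := cf_q alpha (S n) in
  ln (sine_prod q alpha) =
  ln (2 * (INR q * sin (PI * scaled_dist (S n) / INR q))) + rsum (log_factor (S n)) (seq 1 (q - 1)).
Proof.
intros q. pose proof (cf_q_pos n) as q1. fold q in q1.
pose proof (le_INR _ _ q1) as Q. simpl (INR 1) in Q. pose proof (scaled_dist_bounds n) as LB.
rewrite (proj2 (ln_sine_prod q)).
set (G := fun r => ln (Rabs (2 * sin (PI * INR r * alpha)))).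
assert (q0 : 0 < sin (PI * scaled_dist (S n) / INR q)) by (apply sin_frac_pos; lra).
replace q with (S (q - 1)) at 1 by lia. rewrite rsum_seq_S.
replace (1 + (q - 1))%nat with q by lia.
destruct (cf_approx n) as (p & p' & e & he & det & app). fold q in det, app.
assert (Gq : G q = ln (2 * sin (PI * scaled_dist (S n) / INR q))).
{ unfold G. f_equal. rewrite Rabs_mult, (Rabs_pos_eq 2) by lra. f_equal.
  replace (PI * INR q * alpha) with (- (IZR e * (PI * scaled_dist (S n) / INR q)) + IZR p * PI).
  - rewrite Rabs_sin_add_IZR_PI, sin_neg, Rabs_Ropp. destruct he as [-> | ->].
    + rewrite Rmult_1_l. apply Rabs_pos_eq. lra.
    + replace (-1 * (PI * scaled_dist (S n) / INR q)) with (- (PI * scaled_dist (S n) / INR q)) by ring.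
      rewrite sin_neg, Rabs_Ropp. apply Rabs_pos_eq. lra.
  - rewrite Rmult_assoc, app. field. lra. }
assert (C : forall f : nat -> R, rsum f (seq 0 q) = f O + rsum f (seq 1 (q - 1))).
{ intros f. replace q with (S (q - 1)) at 1 by lia. reflexivity. }
assert (P : rsum G (seq 1 (q - 1)) =
  rsum (fun t => ln (2 * sin (PI * INR t / INR q)) + log_factor (S n) t) (seq 1 (q - 1))).
{ pose proof (rsum_affine_mod G q 0 (Z.of_nat (cf_q alpha n)) (e * p) (- e * p') ltac:(lia)) as A.
  specialize (A ltac:(destruct he as [-> | ->]; lia)).
  (* The residue 0 contributes [G 0], the logarithm of zero, to both sides; it cancels whatever
     value [ln] takes there. *)
  rewrite !C in A. cbv beta in A. replace (Z.to_nat _) with O in A at 1.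
  2:{ change (Z.of_nat 0) with 0%Z. rewrite Z.mul_0_l, Z.add_0_l, Z.mod_0_l by lia. reflexivity. }
  apply Rplus_eq_reg_l in A. rewrite <- A. apply rsum_ext. intros t ht. apply in_seq in ht.
  destruct (sin_orbit n t) as [_ so]. fold q in so. unfold G.
  rewrite Rabs_mult, so, (Rabs_pos_eq 2) by lra. fold (shifted (S n) t).
  pose proof (shifted_bounds n t ltac:(lia)) as sb.
  assert (tq : INR t < INR q) by (apply lt_INR; lia).
  pose proof (sin_frac_pos (shifted (S n) t) (INR q) ltac:(lra)).
  pose proof (sin_frac_pos (INR t) (INR q) ltac:(lra)).
  unfold log_factor. fold q. rewrite Rabs_pos_eq by lra. rewrite <- ln_mult; [|lra|now apply Rdiv_lt_0_compat].
  f_equal. field. lra. }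
rewrite P, rsum_plus, rsum_ln_two_sin, Gq by lia.
replace (2 * (INR q * sin (PI * scaled_dist (S n) / INR q))) with (INR q * (2 * sin (PI * scaled_dist (S n) / INR q))) by ring.
rewrite (ln_mult (INR q)) by lra. lra.
Qed.

Definition log_pair (n t : nat) : R := log_factor n t + log_factor n (cf_q alpha n - t).

(** By [theta_rev] and sin (pi - x) = sin x, the factor at q - t is the factor at t with theta
    replaced by theta - 1. *)
Lemma log_factor_rev (n t : nat) : (1 <= t < cf_q alpha (S n))%nat ->
  log_factor (S n) (cf_q alpha (S n) - t) =
  ln (sin (PI * (INR t + scaled_dist (S n) * (1 - theta (S n) t)) / INR (cf_q alpha (S n))) /
      sin (PI * INR t / INR (cf_q alpha (S n)))).
Proof.
intros ht. unfold log_factor, shifted. rewrite theta_rev, minus_INR by lia.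
set (q := cf_q alpha (S n)) in *.
assert (Q : 0 < INR q) by (apply lt_0_INR; lia).
rewrite <- (sin_PI_x (PI * INR t / INR q)).
rewrite <- (sin_PI_x (PI * (INR t + scaled_dist (S n) * (1 - theta (S n) t)) / INR q)).
replace (PI - PI * INR t / INR q) with (PI * (INR q - INR t) / INR q) by (field; lra).
replace (PI - PI * (INR t + scaled_dist (S n) * (1 - theta (S n) t)) / INR q) with
  (PI * (INR q - INR t - scaled_dist (S n) * (1 - theta (S n) t)) / INR q) by (field; lra).
reflexivity.
Qed.

(** The pairs over the full range count every factor twice, hence the half. Their symmetry under t
    -> q - t folds the upper part of the range onto an initial segment; two lengths h and h' handle
    both parities of q at once. *)
Lemma ln_sine_prod_pair (n h h' : nat) : (h + h' = cf_q alpha (S n) - 1)%nat ->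
  ln (sine_prod (cf_q alpha (S n)) alpha) =
  ln (2 * (INR (cf_q alpha (S n)) * sin (PI * scaled_dist (S n) / INR (cf_q alpha (S n))))) +
  (rsum (log_pair (S n)) (seq 1 h) + rsum (log_pair (S n)) (seq 1 h')) / 2.
Proof.
intros hh. rewrite ln_sine_prod_q. f_equal. pose proof (cf_q_pos n).
set (q := cf_q alpha (S n)) in *.
assert (E : rsum (log_pair (S n)) (seq 1 (q - 1)) = 2 * rsum (log_factor (S n)) (seq 1 (q - 1))).
{ replace (2 * rsum (log_factor (S n)) (seq 1 (q - 1))) with
    (rsum (log_factor (S n)) (seq 1 (q - 1)) + rsum (log_factor (S n)) (seq 1 (q - 1))) by ring.
  rewrite (rsum_rev (log_factor (S n))) at 2. rewrite <- rsum_plus. apply rsum_ext. intros t ht.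
  apply in_seq in ht. unfold log_pair. fold q. f_equal. f_equal. lia. }
set (X := rsum (log_factor (S n)) (seq 1 (q - 1))) in *.
rewrite <- hh, seq_app, rsum_app in E.
replace (rsum (log_pair (S n)) (seq (1 + h) h')) with (rsum (log_pair (S n)) (seq 1 h')) in E; [lra|].
rewrite (rsum_rev _ (1 + h)), rsum_shift, (rsum_shift _ (1 + h)).
apply rsum_ext. intros t ht. apply in_seq in ht. unfold log_pair. fold q.
rewrite Rplus_comm. f_equal; f_equal; lia.
Qed.

(** The inserted factors q cancel, as 1 + 1 - 2 = 0. They make each logarithm converge separately
    for fixed t, since q sin (pi x / q) tends to pi x. *)
Lemma log_pair_ln_sin (n t : nat) : (1 <= t < cf_q alpha (S n))%nat ->
  let q := INR (cf_q alpha (S n)) in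
  log_pair (S n) t =
  ln (q * sin (PI * (INR t - scaled_dist (S n) * theta (S n) t) / q)) +
  ln (q * sin (PI * (INR t + scaled_dist (S n) * (1 - theta (S n) t)) / q)) -
  2 * ln (q * sin (PI * INR t / q)).
Proof.
intros ht q. unfold log_pair. rewrite log_factor_rev by exact ht. unfold log_factor, shifted. fold q.
pose proof (shifted_bounds n t ltac:(lia)) as B. unfold shifted in B.
pose proof (scaled_dist_bounds n) as LB.
pose proof (frac_bounds (INR t * alpha_minus alpha (S n))) as F. fold (theta (S n) t) in F.
assert (QT : INR t + 1 <= q) by (rewrite <- S_INR; apply le_INR; lia).
pose proof (sin_frac_pos (INR t - scaled_dist (S n) * theta (S n) t) q ltac:(lra)) as s1.
pose proof (sin_frac_pos (INR t) q ltac:(lra)) as s2.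
pose proof (sin_frac_pos (INR t + scaled_dist (S n) * (1 - theta (S n) t)) q ltac:(nra)) as s3.
assert (LD : forall x y, 0 < x -> 0 < y -> ln (x / y) = ln x - ln y).
{ intros x y hx hy. unfold Rdiv.
  rewrite ln_mult, ln_Rinv by auto using Rinv_0_lt_compat. reflexivity. }
rewrite !LD, !ln_mult by lra. ring.
Qed.

(** * Estimates uniform in n for bounded coefficients *)

Section BoundedCoefficients.
Variable M : nat.
Hypothesis cf_a_le : forall k : nat, (1 <= k)%nat -> (cf_a alpha k <= M)%nat.

Lemma rsum_theta_sqrt (n t : nat) : (1 <= t)%nat -> (S t <= cf_q alpha (S n))%nat ->
  Rabs (rsum (fun j => theta (S n) j - / 2) (seq 0 (S t))) <= 2 * (INR M + 11) * sqrt (INR t).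
Proof.
intros t1 tq. pose proof (Nat.sqrt_spec (S t) ltac:(lia)) as sp.
destruct (alpha_minus_select M n (Nat.sqrt (S t)) cf_a_le) as (k & h & u & v & hk & bez & ap).
- split; nia.
- eapply Rle_trans; [apply (rsum_frac_sqrt _ M (S t) k h u v); auto; lia|].
  assert (sqrt (INR (S t)) <= 2 * sqrt (INR t)).
  { rewrite <- (sqrt_square 2) at 1 by lra. rewrite <- sqrt_mult_alt by lra.
    apply sqrt_le_1_alt. apply le_INR in t1. simpl (INR 1) in t1. rewrite S_INR. lra. }
  pose proof (pos_INR M). nra.
Qed.

(** Apply [frac_away] to a convergent denominator k with 2 t <= k <= 2 (M + 1) t; the margin is then
    independent of n. *)
Lemma theta_away (n t : nat) : (1 <= t)%nat -> (2 * t <= cf_q alpha (S n))%nat ->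
  / (4 * INR (M + 1) * INR t) <= theta (S n) t <= 1 - / (4 * INR (M + 1) * INR t).
Proof.
intros t1 tq.
destruct (alpha_minus_select M n (2 * t) cf_a_le ltac:(lia)) as (k & h & u & v & hk & bez & ap).
pose proof (frac_away _ t k h u v t1 ltac:(lia) bez ap) as F. fold (theta (S n) t) in F.
assert (K : 0 < INR k) by (apply lt_0_INR; lia).
assert (KM : INR k <= 2 * INR (M + 1) * INR t).
{ replace 2 with (INR 2) by (simpl; lra). rewrite <- !mult_INR. apply le_INR. lia. }
assert (/ (4 * INR (M + 1) * INR t) <= / (2 * INR k)) by (apply Rinv_le_contravar; lra).
lra.
Qed.

(** [ln_sin_ratio] is used at z = s theta and z = s (theta - 1), with s = pi lam / q. The linear
    terms add up to 2 s cot a (theta - 1/2), the errors to 2 * 16. *)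
Lemma log_pair_estimate (n t : nat) : (5 <= t)%nat -> (2 * t <= cf_q alpha (S n))%nat ->
  let a := PI * INR t / INR (cf_q alpha (S n)) in
  Rabs (log_pair (S n) t + 2 * (PI * scaled_dist (S n) / INR (cf_q alpha (S n)) * (cos a / sin a) * (theta (S n) t - / 2)))
    <= 32 * / (INR t * INR t).
Proof.
intros t5 tq a. set (q := cf_q alpha (S n)) in *.
assert (Q : 0 < INR q) by (apply lt_0_INR; lia).
apply le_INR in t5. replace (INR 5) with 5 in t5 by (simpl; lra).
assert (TQ : 2 * INR t <= INR q).
{ replace 2 with (INR 2) by (simpl; lra). rewrite <- mult_INR. now apply le_INR. }
pose proof PI_RGT_0 as P0. pose proof (scaled_dist_bounds n) as LB.
pose proof (frac_bounds (INR t * alpha_minus alpha (S n))) as F. fold (theta (S n) t) in F.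
assert (ha : 0 < a <= PI / 2).
{ unfold a. split; [apply Rdiv_lt_0_compat; nra|].
  apply Rmult_le_reg_r with (INR q); [lra|]. field_simplify; nra. }
assert (hz : forall phi, Rabs phi <= 1 -> Rabs (PI * scaled_dist (S n) / INR q * phi) <= a / INR t).
{ intros phi hp. replace (a / INR t) with (PI * 1 / INR q) by (unfold a; field; lra).
  rewrite Rabs_mult, Rabs_pos_eq by (apply Rle_mult_inv_pos; nra).
  unfold Rdiv. assert (0 < / INR q) by now apply Rinv_0_lt_compat. pose proof (Rabs_pos phi).
  assert (scaled_dist (S n) * Rabs phi <= 1) by nra.
  replace (PI * scaled_dist (S n) * / INR q * Rabs phi) with (PI * / INR q * (scaled_dist (S n) * Rabs phi)) by ring.
  replace (PI * 1 * / INR q) with (PI * / INR q * 1) by ring.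
  apply Rmult_le_compat_l; nra. }
pose proof (ln_sin_ratio a _ (INR t) t5 ha (hz (theta (S n) t) ltac:(apply Rabs_le; lra))) as L1.
pose proof (ln_sin_ratio a _ (INR t) t5 ha (hz (theta (S n) t - 1) ltac:(apply Rabs_le; lra))) as L2.
unfold log_pair. fold q. rewrite log_factor_rev.
2:{ fold q. split; apply INR_le; [simpl; lra|]. rewrite S_INR. assert (INR t + 1 <= INR q) by lra. lra. }
unfold log_factor, shifted. fold q.
replace (PI * (INR t - scaled_dist (S n) * theta (S n) t) / INR q) with
  (a - PI * scaled_dist (S n) / INR q * theta (S n) t) by (unfold a; field; lra).
replace (PI * (INR t + scaled_dist (S n) * (1 - theta (S n) t)) / INR q) with
  (a - PI * scaled_dist (S n) / INR q * (theta (S n) t - 1)) by (unfold a; field; lra).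
fold a. apply Rabs_le_inv in L1, L2. apply Rabs_le.
set (X := ln _) in *. set (Y := ln _) in *. set (ct := cos a / sin a) in *.
set (s := PI * scaled_dist (S n) / INR q) in *. unfold Rdiv in L1, L2. lra.
Qed.

(** The weights (pi lam / q) cot (pi t / q) decrease and are at most 1/t, since lam < 1 and cot a <=
    1/a; so [abel_sqrt] applies. The quadratic errors give 32, the linear terms 2 * 3 * 2 (M +
    11). *)
Lemma log_pair_tail (n T m : nat) : (5 <= T)%nat -> (2 * (T + m) <= cf_q alpha (S n))%nat ->
  Rabs (rsum (log_pair (S n)) (seq (S T) m)) <= (32 + 12 * (INR M + 11)) / sqrt (INR T).
Proof.
intros T5 Tm. set (q := cf_q alpha (S n)) in *.
assert (Q : 0 < INR q) by (apply lt_0_INR; lia).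
pose proof PI_RGT_0 as P0. pose proof (scaled_dist_bounds n) as LB.
set (a := fun t : nat => PI * INR t / INR q).
set (c := fun t => PI * scaled_dist (S n) / INR q * (cos (a t) / sin (a t))).
assert (D : 0 <= PI * scaled_dist (S n) / INR q <= PI / INR q).
{ assert (0 < / INR q) by now apply Rinv_0_lt_compat. unfold Rdiv.
  split; [apply Rmult_le_pos; nra | apply Rmult_le_compat_r; nra]. }
assert (ha : forall t, (T <= t <= T + m)%nat -> 0 < a t <= PI / 2).
{ intros t ht. unfold a.
  assert (0 < INR t) by (apply lt_0_INR; lia).
  assert (2 * INR t <= INR q).
  { replace 2 with (INR 2) by (simpl; lra). rewrite <- mult_INR. apply le_INR. lia. }
  split; [apply Rdiv_lt_0_compat; nra|].
  apply Rmult_le_reg_r with (INR q); [lra|]. field_simplify; nra. }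
pose proof (pos_INR M) as M0.
pose proof (abel_sqrt (fun t => theta (S n) t - / 2) c (2 * (INR M + 11)) T
  ltac:(lra) ltac:(lia) m) as AB.
assert (AB' : Rabs (rsum (fun t => c t * (theta (S n) t - / 2)) (seq (S T) m)) <=
  3 * (2 * (INR M + 11)) / sqrt (INR T)).
{ apply AB.
  - intros t ht. apply rsum_theta_sqrt; [lia|]. fold q. lia.
  - intros t ht. destruct (cot_le_inv (a t) (ha t ht)) as [c0 c1]. unfold c.
    split; [apply Rmult_le_pos; lra|].
    assert (0 < INR t) by (apply lt_0_INR; lia).
    replace (/ INR t) with (PI / INR q * / a t) by (unfold a; field; lra).
    apply Rmult_le_compat; lra.
  - intros t ht. unfold c. apply Rmult_le_compat_l; [lra|].
    pose proof (ha t ltac:(lia)). pose proof (ha (S t) ltac:(lia)).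
    apply cot_antitone; try lra. unfold a. rewrite S_INR.
    apply Rmult_le_compat_r; [left; now apply Rinv_0_lt_compat|]. nra. }
assert (R1 : Rabs (rsum (fun t => log_pair (S n) t + 2 * (c t * (theta (S n) t - / 2))) (seq (S T) m)) <= 32 * / INR T).
{ eapply Rle_trans; [apply (rsum_abs _ (fun t => 32 * / (INR t * INR t)))|].
  - intros t ht. apply in_seq in ht. apply log_pair_estimate; [lia|]. fold q. lia.
  - rewrite rsum_scal. pose proof (rsum_inv_sq T m ltac:(lia)).
    assert (0 < / INR (T + m)) by (apply Rinv_0_lt_compat, lt_0_INR; lia). lra. }
rewrite rsum_plus, rsum_scal in R1.
assert (T1 : 1 <= INR T) by (apply le_INR in T5; simpl in T5; lra).
assert (S1 : 1 <= sqrt (INR T)) by (rewrite <- sqrt_1; apply sqrt_le_1_alt; lra).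
assert (IT : / INR T <= / sqrt (INR T)).
{ apply Rinv_le_contravar; [lra|]. rewrite <- (sqrt_sqrt (INR T)) at 2 by lra. nra. }
unfold Rdiv in *. apply Rabs_le_inv in AB', R1. apply Rabs_le. lra.
Qed.

(** Both folded halves start with the same T pairs, so their average contains these once and
    averages two tails with one common bound. 2 T + 2 <= q makes even the shorter half at least T
    long. *)
Lemma ln_sine_prod_approx (n T : nat) : (5 <= T)%nat -> (2 * T + 2 <= cf_q alpha (S n))%nat ->
  Rabs (ln (sine_prod (cf_q alpha (S n)) alpha) -
    (ln (2 * (INR (cf_q alpha (S n)) * sin (PI * scaled_dist (S n) / INR (cf_q alpha (S n))))) +
     rsum (log_pair (S n)) (seq 1 T))) <= (32 + 12 * (INR M + 11)) / sqrt (INR T).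
Proof.
intros T5 Tq. pose proof (Nat.div_mod (cf_q alpha (S n)) 2 ltac:(lia)) as dm.
pose proof (Nat.mod_upper_bound (cf_q alpha (S n)) 2 ltac:(lia)) as mb.
set (h := (cf_q alpha (S n) / 2)%nat) in *.
rewrite (ln_sine_prod_pair n h (cf_q alpha (S n) - 1 - h)) by lia.
replace h with (T + (h - T))%nat at 1 by lia.
replace (cf_q alpha (S n) - 1 - h)%nat with (T + (cf_q alpha (S n) - 1 - h - T))%nat by lia.
rewrite !seq_app, !rsum_app.
pose proof (log_pair_tail n T (h - T) T5 ltac:(lia)) as L1.
pose proof (log_pair_tail n T (cf_q alpha (S n) - 1 - h - T) T5 ltac:(lia)) as L2.
change (1 + T)%nat with (S T).
apply Rabs_le_inv in L1, L2. apply Rabs_le. lra.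
Qed.
End BoundedCoefficients.

End Alpha.

(** * Limits of real sequences and the conclusion *)

Lemma Un_cv_const (c : R) : Un_cv (fun _ => c) c.
Proof. intros e he. exists O. intros. unfold Rdist. rewrite Rminus_diag, Rabs_R0. exact he. Qed.

Lemma Un_cv_eventually (u v : nat -> R) (l : R) (N : nat) :
  (forall i, (N <= i)%nat -> u i = v i) -> Un_cv u l -> Un_cv v l.
Proof.
intros h hu e he. destruct (hu e he) as [N' hN]. exists (max N N'). intros i hi.
rewrite <- h by lia. apply hN. lia.
Qed.

(** [frac_part] jumps at the integers; the margin [c] together with convergence freezes the integer
    part from some index on. *)
Lemma frac_cv (x : nat -> R) (l c : R) (N : nat) : 0 < c ->
  (forall i, (N <= i)%nat -> c <= frac_part (x i) <= 1 - c) -> Un_cv x l ->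
  Un_cv (fun i => frac_part (x i)) (frac_part l).
Proof.
intros c0 hx hl. destruct (hl (c / 4) ltac:(lra)) as [N1 h1].
set (j := max N N1). set (z := Int_part (x j)).
assert (B : forall i, (j <= i)%nat -> Rabs (x i - l) < c / 4).
{ intros i hi. apply h1. unfold j in hi. lia. }
pose proof (Rabs_def2 _ _ (B j (le_n j))) as Bj.
pose proof (hx j ltac:(unfold j; lia)) as hj.
assert (E : x j = IZR z + frac_part (x j)) by (unfold frac_part, z; lra).
assert (Fl : frac_part l = l - IZR z) by (apply (frac_unique _ _ z); lra).
apply (Un_cv_eventually (fun i => x i - IZR z) _ _ j).
- intros i hi. pose proof (Rabs_def2 _ _ (B i hi)). symmetry. apply (frac_unique _ _ z); lra.
- rewrite Fl. apply CV_minus; [exact hl | apply Un_cv_const].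
Qed.

Lemma ln_cv (u : nat -> R) (l : R) : 0 < l -> Un_cv u l -> Un_cv (fun i => ln (u i)) (ln l).
Proof.
intros l0 hu. apply continuity_seq; [|exact hu].
apply derivable_continuous_pt. exists (/ l). now apply derivable_pt_lim_ln.
Qed.

Lemma Rinv_cv (u : nat -> R) (l : R) : l <> 0 -> Un_cv u l -> Un_cv (fun i => / u i) (/ l).
Proof.
intros l0 hu. apply (continuity_seq (fun x => / x)); [|exact hu].
apply (continuity_pt_inv id); [|exact l0]. apply derivable_continuous_pt, derivable_pt_id.
Qed.

(** From |sin y - y| <= y^2 the error |q sin (x/q) - x| is at most x^2/q. *)
Lemma mult_sin_div_cv (q x : nat -> R) (l : R) : (forall i, 0 < q i) -> cv_infty q -> Un_cv x l ->
  Un_cv (fun i => q i * sin (x i / q i)) l.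
Proof.
intros q0 hq hx.
assert (I : Un_cv (fun i => / q i) 0).
{ now apply cv_infty_cv_0. }
assert (S1 : Un_cv (fun i => x i * / q i) 0).
{ replace 0 with (l * 0) by ring. now apply CV_mult. }
assert (S2 : Un_cv (fun i => x i * (x i * / q i)) 0).
{ replace 0 with (l * 0) by ring. now apply CV_mult. }
intros e he. destruct (S1 2 ltac:(lra)) as [N1 h1]. destruct (S2 (e / 2) ltac:(lra)) as [N2 h2].
destruct (hx (e / 2) ltac:(lra)) as [N3 h3].
exists (max N1 (max N2 N3)). intros i hi.
specialize (h1 i ltac:(lia)). specialize (h2 i ltac:(lia)). specialize (h3 i ltac:(lia)).
unfold Rdist in *. rewrite Rminus_0_r in h1, h2. specialize (q0 i).
destruct (sin_cos_taylor_abs (x i / q i)) as [_ [s _]]; [unfold Rdiv; lra|].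
assert (X : Rabs (q i * sin (x i / q i) - x i) <= Rabs (x i * (x i * / q i))).
{ replace (q i * sin (x i / q i) - x i) with (q i * (sin (x i / q i) - x i / q i)) by (field; lra).
  rewrite Rabs_mult, (Rabs_pos_eq (q i)) by lra.
  apply Rle_trans with (q i * (x i / q i * (x i / q i))); [apply Rmult_le_compat_l; lra|].
  replace (q i * (x i / q i * (x i / q i))) with (x i * (x i * / q i)) by (field; lra).
  apply Rle_abs. }
replace (q i * sin (x i / q i) - l) with ((q i * sin (x i / q i) - x i) + (x i - l)) by ring.
eapply Rle_lt_trans; [apply Rabs_triang|]. lra.
Qed.

Lemma rsum_cv (f : nat -> nat -> R) (a m : nat) :
  (forall t, (a <= t)%nat -> exists l, Un_cv (fun i => f i t) l) ->
  exists l, Un_cv (fun i => rsum (f i) (seq a m)) l.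
Proof.
intros h. induction m as [|m [l hl]]; [exists 0; exact (Un_cv_const 0)|].
destruct (h (a + m)%nat ltac:(lia)) as [l' hl']. exists (l + l').
apply (Un_cv_eventually (fun i => rsum (f i) (seq a m) + f i (a + m)%nat) _ _ O).
- intros i _. symmetry. apply rsum_seq_S.
- now apply CV_plus.
Qed.

(** The convergent approximation may change with [e]; it transfers the Cauchy property to [u], so
    the limit is obtained without a formula for it. *)
Lemma cv_of_approx (u : nat -> R) :
  (forall e, 0 < e -> exists (v : nat -> R) (l : R) (N : nat), Un_cv v l /\
     forall i, (N <= i)%nat -> Rabs (u i - v i) <= e) ->
  exists l, Un_cv u l.
Proof.
intros h. destruct (R_complete u) as [l hl]; [|now exists l].
intros e he. destruct (h (e / 8) ltac:(lra)) as (v & l & N & hv & huv).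
destruct (hv (e / 8) ltac:(lra)) as [N' hN].
exists (max N N'). intros i j hi hj. unfold Rdist in *.
pose proof (huv i ltac:(lia)) as a1. pose proof (huv j ltac:(lia)) as a2.
pose proof (hN i ltac:(lia)) as a3. pose proof (hN j ltac:(lia)) as a4.
apply Rabs_le_inv in a1, a2. apply Rabs_def2 in a3, a4. apply Rabs_def1; lra.
Qed.

Theorem theorem1p5 (alpha : R) (n : nat -> nat) (Lp Lm : R) :
  0 < alpha < 1 ->
  irrational alpha ->
  (exists M : nat, forall k : nat, (1 <= k)%nat -> (cf_a alpha k <= M)%nat) ->
  (forall i : nat, (0 < n i)%nat) ->
  (forall i : nat, (n i < n (S i))%nat) ->
  Un_cv (fun i => alpha_plus alpha (n i)) Lp ->
  Un_cv (fun i => alpha_minus alpha (n i)) Lm ->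
  exists C : R, 0 < C /\ Un_cv (fun i => sine_prod (cf_q alpha (n i)) alpha) C.
Proof.
intros a01 irr [M hM] npos nincr hp hm.
assert (nS : forall i, n i = S (pred (n i))) by (intros i; specialize (npos i); lia).
assert (nge : forall i, (S i <= n i)%nat).
{ induction i as [|i IH]; [apply npos|]. specialize (nincr i). lia. }
set (q := fun i => cf_q alpha (n i)).
assert (qge : forall i, (i <= q i)%nat).
{ intros i. pose proof (cf_q_ge alpha a01 irr (n i)). specialize (nge i). unfold q. lia. }
assert (qpos : forall i, (1 <= q i)%nat).
{ intros i. unfold q. rewrite nS. now apply cf_q_pos. }
assert (qposR : forall i, 0 < INR (q i)) by (intros i; apply lt_0_INR, qpos).
assert (qinf : cv_infty (fun i => INR (q i))).
{ intros B. destruct (INR_unbounded B) as [N hN]. exists N. intros i hi.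
  apply Rlt_le_trans with (INR N); [exact hN|]. apply le_INR. specialize (qge i). lia. }
(* alpha_n^+ = 1/x_{n-1} > 1. Thus Lp + Lm >= 1, and the limit [L] of [scaled_dist] lies in (0,
   1]. *)
assert (lp : 1 <= Lp).
{ apply (@Rle_cv_lim (fun _ => 1) (fun i => alpha_plus alpha (n i))); auto using Un_cv_const.
  intros i. rewrite nS, alpha_plus_gauss by assumption.
  destruct (gauss_irr alpha a01 irr (pred (n i))) as [r _].
  rewrite <- Rinv_1. apply Rinv_le_contravar; lra. }
assert (lm : 0 <= Lm).
{ apply (@Rle_cv_lim (fun _ => 0) (fun i => alpha_minus alpha (n i))); auto using Un_cv_const.
  intros i. now apply alpha_minus_bounds. }
set (L := / (Lp + Lm)).
assert (hL : 0 < L <= 1).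
{ unfold L. split; [apply Rinv_0_lt_compat; lra|]. rewrite <- Rinv_1. apply Rinv_le_contravar; lra. }
assert (clam : Un_cv (fun i => scaled_dist alpha (n i)) L).
{ apply Rinv_cv; [lra|]. now apply CV_plus. }
assert (csin : forall (x : nat -> R) l, 0 < l -> Un_cv x l ->
  Un_cv (fun i => ln (INR (q i) * sin (PI * x i / INR (q i)))) (ln (PI * l))).
{ intros x l l0 hx. pose proof PI_RGT_0. apply ln_cv; [nra|].
  apply mult_sin_div_cv; auto. apply CV_mult; auto using Un_cv_const. }
assert (cpair : forall t, (1 <= t)%nat -> exists l, Un_cv (fun i => log_pair alpha (n i) t) l).
{ intros t t1. set (th := frac_part (INR t * Lm)).
  assert (t1R := le_INR _ _ t1). simpl (INR 1) in t1R.
  pose proof (frac_bounds (INR t * Lm)) as F. fold th in F.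
  assert (cth : Un_cv (fun i => theta alpha (n i) t) th).
  { apply (frac_cv _ _ (/ (4 * INR (M + 1) * INR t)) (2 * t)).
    - apply Rinv_0_lt_compat. assert (0 < INR (M + 1)) by (apply lt_0_INR; lia). nra.
    - intros i hi. rewrite nS. apply (theta_away alpha a01 irr M hM); [exact t1|].
      rewrite <- nS. fold (q i). specialize (qge i). lia.
    - apply CV_mult; auto using Un_cv_const. }
  exists (ln (PI * (INR t - L * th)) + ln (PI * (INR t + L * (1 - th))) - 2 * ln (PI * INR t)).
  apply (Un_cv_eventually (fun i =>
     ln (INR (q i) * sin (PI * (INR t - scaled_dist alpha (n i) * theta alpha (n i) t) / INR (q i))) +
     ln (INR (q i) * sin (PI * (INR t + scaled_dist alpha (n i) * (1 - theta alpha (n i) t)) / INR (q i))) -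
     2 * ln (INR (q i) * sin (PI * INR t / INR (q i)))) _ _ (S t)).
  - intros i hi. specialize (qge i). specialize (qposR i).
    pose proof (log_pair_ln_sin alpha a01 irr (pred (n i)) t) as E.
    rewrite <- nS in E. symmetry. apply E. fold (q i). lia.
  - apply CV_minus; [apply CV_plus|].
    (* L <= 1 and th < 1 <= t keep t - L th positive, so [ln] is continuous at the limit. *)
    + apply csin; [nra|]. apply CV_minus; auto using Un_cv_const, CV_mult.
    + apply csin; [nra|]. apply CV_plus; auto using Un_cv_const.
      apply CV_mult; auto. apply CV_minus; auto using Un_cv_const.
    + apply CV_mult; auto using Un_cv_const. apply csin; [lra|]. apply Un_cv_const. }
assert (X : exists l, Un_cv (fun i => ln (sine_prod (q i) alpha)) l).
{ apply cv_of_approx. intros e he. set (K := 32 + 12 * (INR M + 11)).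
  assert (K0 : 0 < K) by (unfold K; pose proof (pos_INR M); lra).
  (* T > (K/e)^2 brings the tail bound K / sqrt T below e; 5 is the threshold of
     [log_pair_estimate]. *)
  destruct (INR_unbounded (K / e * (K / e))) as [T0 hT0]. set (T := max T0 5).
  assert (hT : K / sqrt (INR T) <= e).
  { assert (K / e < sqrt (INR T)).
    { rewrite <- (sqrt_square (K / e)) by (apply Rle_mult_inv_pos; lra).
      apply sqrt_lt_1_alt. split; [nra|]. apply Rlt_le_trans with (INR T0); [exact hT0|].
      apply le_INR. unfold T. lia. }
    assert (0 < K / e) by now apply Rdiv_lt_0_compat.
    apply Rmult_le_reg_r with (sqrt (INR T)); [lra|]. unfold Rdiv at 1.
    rewrite Rmult_assoc, Rinv_l, Rmult_1_r by lra.
    replace K with (e * (K / e)) by (field; lra). apply Rmult_le_compat_l; lra. }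
  destruct (rsum_cv (fun i => log_pair alpha (n i)) 1 T cpair) as [l hl].
  pose proof (csin _ L (proj1 hL) clam) as cl.
  exists (fun i => ln 2 + ln (INR (q i) * sin (PI * scaled_dist alpha (n i) / INR (q i))) +
    rsum (log_pair alpha (n i)) (seq 1 T)), (ln 2 + ln (PI * L) + l), (2 * T + 2)%nat.
  split; [repeat apply CV_plus; auto using Un_cv_const|].
  intros i hi.
  pose proof (ln_sine_prod_approx alpha a01 irr M hM (pred (n i)) T) as A.
  rewrite <- nS in A. fold (q i) K in A. specialize (qge i).
  specialize (A ltac:(unfold T; lia) ltac:(lia)).
  rewrite ln_mult in A; [lra | lra |].
  pose proof (scaled_dist_bounds alpha a01 irr (pred (n i))) as LB. rewrite <- nS in LB.
  apply Rmult_lt_0_compat; [apply qposR|]. apply sin_frac_pos.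
  pose proof (le_INR _ _ (qpos i)) as q1. simpl (INR 1) in q1. lra. }
destruct X as [l hl]. exists (exp l). split; [apply exp_pos|].
apply (Un_cv_eventually (fun i => exp (ln (sine_prod (q i) alpha))) _ _ O).
- intros i _. apply exp_ln, (ln_sine_prod alpha irr (q i)).
- apply continuity_seq; [|exact hl]. apply derivable_continuous_pt, derivable_pt_exp.
Qed.
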